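(* Let $\mu$ be a positive finite Borel measure on $[0,1)$ and let $v,w$ be weights on $\mathbb{D}$ with $1/v\in L_1([0,1),\mu)$. Consider: (i) $\lim_{r\to1^-}w(r)\int_0^1\frac{d\mu(t)}{v(t)(1-tr)}=0$; (ii) $I_\mu:H^\infty_v\to H^0_w$ is (well defined and) compact; (iii) $I_\mu:H^\infty_v\to H^\infty_w$ is (well defined and) compact and $I_\mu(1)\in H^0_w$; (iv) $I_\mu:H^\infty_v\to H^0_w$ is (well defined and) continuous. Then (i) implies (ii), (ii) implies (iii), and (iii) implies (iv). If in addition $v$ is essential, the four conditions are equivalent.
   Context: $\mathbb{D}$ is the open unit disc and $H(\mathbb{D})$ the holomorphic functions on $\mathbb{D}$. A weight is a function $v:\mathbb{D}\to(0,\infty)$ that is radial, continuous, non-increasing in $|z|$, with $\lim_{r\to1^-}v(r)=0$. $H^\infty_v=\{f\in H(\mathbb{D}):\|f\|_v:=\sup_{z}v(z)|f(z)|<\infty\}$ and $H^0_v=\{f\in H^\infty_v:\lim_{|z|\to1^-}v(z)|f(z)|=0\}$, with norm $\|\cdot\|_v$. A weight $v$ is essential if there is $c>0$ with $c/v(z)\le\sup\{|f(z)|:\|f\|_v\le1\}\le1/v(z)$ for all $z\in\mathbb{D}$. $I_\mu(f)(z)=\int_0^1\frac{f(t)}{1-tz}\,d\mu(t)$ whenever this defines a holomorphic function on $\mathbb{D}$. *)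

(* Defs.v *)
From HB Require Import structures.
From mathcomp Require Import all_boot all_order all_algebra.
From mathcomp Require Import all_classical all_reals all_analysis.
From mathcomp Require Import complex.
Set Implicit Arguments.
Unset Strict Implicit.
Unset Printing Implicit Defensive.
Import Order.TTheory GRing.Theory Num.Theory.
Import numFieldNormedType.Exports.
Local Open Scope ring_scope.
Local Open Scope classical_set_scope.

Section WeightedBanach.
Variable R : realType.
Local Notation C := R[i].

Definition cmod (z : C) : R := Num.sqrt (complex.Re z ^+ 2 + complex.Im z ^+ 2).

Definition disc : set C := [set z | cmod z < 1].

Definition cderivable (f : C -> C) (z : C) : Prop :=
  exists L : C, forall e : R, 0 < e -> exists2 d : R, 0 < d &
    forall h : C, 0 < cmod h < d -> cmod ((f (z + h) - f z) / h - L) < e.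

(* f is holomorphic on the open unit disc (values outside D are irrelevant) *)
Definition holomorphic_disc (f : C -> C) : Prop :=
  forall z, disc z -> cderivable f z.

(* A weight: a radial function, given by its radial profile v : [0,1) -> R,
   so that v(z) := v (cmod z). *)
Definition weight (v : R -> R) : Prop :=
  [/\ (forall r, 0 <= r < 1 -> 0 < v r),
      {within `[0, 1[, continuous v},
      (forall r s, 0 <= r -> r <= s -> s < 1 -> v s <= v r) &
      v x @[x --> 1^'-] --> 0].

Definition Hinf (v : R -> R) (f : C -> C) : Prop :=
  holomorphic_disc f /\
  exists M : R, forall z, disc z -> v (cmod z) * cmod (f z) <= M.

Definition wnorm (v : R -> R) (f : C -> C) : R :=
  sup [set v (cmod z) * cmod (f z) | z in disc].

Definition H0 (v : R -> R) (f : C -> C) : Prop :=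
  Hinf v f /\
  forall e : R, 0 < e -> exists2 r : R, r < 1 &
    forall z, disc z -> r < cmod z -> v (cmod z) * cmod (f z) < e.

Definition essential (v : R -> R) : Prop :=
  exists2 c : R, 0 < c & forall z, disc z ->
    c / v (cmod z) <= sup [set cmod (f z) | f in [set f | Hinf v f /\ wnorm v f <= 1]]
    <= 1 / v (cmod z).

Definition cintegrable (mu : {measure set R -> \bar R}) (D : set R) (g : R -> C) :=
  mu.-integrable D (fun t => (complex.Re (g t))%:E) /\
  mu.-integrable D (fun t => (complex.Im (g t))%:E).

Definition cintegral (mu : {measure set R -> \bar R}) (D : set R) (g : R -> C) : C :=
  Complex (Rintegral mu D (fun t => complex.Re (g t))) (Rintegral mu D (fun t => complex.Im (g t))).

Definition Imu_kernel (f : C -> C) (z : C) : R -> C :=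
  fun t => f (Complex t 0) / (1 - Complex t 0 * z).

Definition Imu (mu : {measure set R -> \bar R}) (f : C -> C) : C -> C :=
  fun z => cintegral mu `[0, 1[ (Imu_kernel f z).

Definition Imu_defined (mu : {measure set R -> \bar R}) (f : C -> C) : Prop :=
  (forall z, disc z -> cintegrable mu `[0, 1[ (Imu_kernel f z)) /\
  holomorphic_disc (Imu mu f).

Definition Imu_maps (mu : {measure set R -> \bar R}) (v : R -> R)
  (Y : (C -> C) -> Prop) : Prop :=
  forall f, Hinf v f -> Imu_defined mu f /\ Y (Imu mu f).

(* I_mu : H^infty_v -> (Y, ||.||_w) is compact: the image of the closed unit
   ball of H^infty_v is relatively compact in Y, i.e. every sequence in the
   unit ball has a subsequence whose images converge in Y *)
Definition Imu_compact (mu : {measure set R -> \bar R}) (v w : R -> R)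
  (Y : (C -> C) -> Prop) : Prop :=
  forall fs : nat -> (C -> C), (forall n, Hinf v (fs n) /\ wnorm v (fs n) <= 1) ->
  exists (phi : nat -> nat) (g : C -> C),
    [/\ {homo phi : m n / (m < n)%N >-> (m < n)%N}, Y g &
        (fun n => wnorm w (fun z => Imu mu (fs (phi n)) z - g z)) @ \oo --> 0].

Definition Imu_continuous (mu : {measure set R -> \bar R}) (v w : R -> R) : Prop :=
  forall f, Hinf v f -> forall e : R, 0 < e -> exists2 d : R, 0 < d &
    forall g, Hinf v g -> wnorm v (fun z => g z - f z) < d ->
      wnorm w (fun z => Imu mu g z - Imu mu f z) < e.

End WeightedBanach.

(* Main.v *)
(** For [|f| <= 1/v] one has [|I_mu f (z)| <= 2 Phi(|z|)] with
    [Phi(r) = int dmu(t) / (v(t) (1 - t r))], so (i) sends the unit ball of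
    [H^infty_v] uniformly into [H^0_w].  Compactness needs no normal family
    argument: [I_mu f] is determined by the moments [int f(t) t^k dmu(t)], which
    are bounded, so along a subsequence all of them converge, and then the
    images converge uniformly on compact subsets of the disc.
    For (iii) => (iv), the dilations [f(r z)] are bounded functions, hence have
    images dominated by [I_mu 1] and so in [H^0_w]; compactness and dominated
    convergence pass this to [f].
    For (iv) => (i) it suffices to find one [f] in [H^infty_v] with
    [f(t) >= c / v(t)] on [[0, 1)], and to evaluate [I_mu f] on [[0, 1)].  Since
    [v] is essential, the maximum principle on annuli applied to [f / z^n] gives,
    for each [t], a monomial below [1/v] (up to constants) that is comparable
    with it at [t].  A greedily separated subfamily of extremal monomials
    [M_n r^n] has a sum comparable with [1/v]; this is [f].  The maximum
    principle comes from Goursat's lemma in polar coordinates, because only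
    pointwise complex differentiability is given. *)

Require Import Defs.
From HB Require Import structures.
From mathcomp Require Import all_boot all_order all_algebra.
From mathcomp Require Import all_classical all_reals all_analysis.
From mathcomp Require Import measurable_realfun complex ring lra.
Set Implicit Arguments.
Unset Strict Implicit.
Unset Printing Implicit Defensive.
Import Order.TTheory GRing.Theory Num.Theory.
Import numFieldNormedType.Exports.
Local Open Scope ring_scope.
Local Open Scope classical_set_scope.

(** * Complex differentiation *)

(** The obstacle in (iv) => (i) is that essentiality supplies a different function for each point,
    while one [f] must serve all of them and the integral must not cancel. A lower bound on
    [cmod (f t)] alone would be lost under integration. Monomials with nonnegative coefficients can
    be added without cancellation, and their sum is real on [[0, 1)], where the kernel
    [1 / (1 - t r)] is positive, so the lower bound survives. Holomorphy of a limit never goes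
    through Cauchy's formula. It comes from estimates [cmod ((F n (z + h) - F n z) / h - D n) <= B *
    cmod h] with [B] independent of [n]. They are explicit for [I_mu f], by expanding the kernel,
    and for sums of monomials with nonnegative coefficients, by comparison with a larger real
    radius. Limits are taken along a free ultrafilter, which makes all bounded sequences converge at
    once; a true subsequence is extracted only where compactness asks for one. *)

Section ComplexModulus.
Variable R : realType.
Local Notation C := R[i].
Implicit Types (z w : C) (x y : R).

Lemma cmodE z : cmod z = ComplexField.Normc.normc z.
Proof. by case: z. Qed.

Lemma cmod0 : cmod (0 : C) = 0.
Proof. by rewrite cmodE ComplexField.Normc.normc0. Qed.

Lemma cmod1 : cmod (1 : C) = 1.
Proof. by rewrite cmodE ComplexField.Normc.normc1. Qed.

Lemma cmod_ge0 z : 0 <= cmod z.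
Proof. exact: sqrtr_ge0. Qed.

Lemma cmod_eq0 z : (cmod z == 0) = (z == 0).
Proof.
apply/idP/idP => [/eqP|/eqP ->]; last by rewrite cmod0.
by rewrite cmodE => /ComplexField.Normc.eq0_normc ->.
Qed.

Lemma cmod_gt0 z : (0 < cmod z) = (z != 0).
Proof. by rewrite lt_def cmod_eq0 cmod_ge0 andbT. Qed.

Lemma cmodM z w : cmod (z * w) = cmod z * cmod w.
Proof. by rewrite !cmodE ComplexField.Normc.normcM. Qed.

Lemma cmodV z : cmod z^-1 = (cmod z)^-1.
Proof. by rewrite !cmodE ComplexField.Normc.normcV. Qed.

Lemma cmodX z n : cmod (z ^+ n) = cmod z ^+ n.
Proof. by elim: n => [|n IH]; rewrite ?cmod1// !exprS cmodM IH. Qed.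

Lemma cmodN z : cmod (- z) = cmod z.
Proof. by rewrite !cmodE normcN. Qed.

Lemma cmodB z w : cmod (z - w) = cmod (w - z).
Proof. by rewrite -cmodN opprB. Qed.

Lemma cmodD z w : cmod (z + w) <= cmod z + cmod w.
Proof. by rewrite !cmodE le_normcD. Qed.

Lemma cmod_tri z w t : cmod (z - t) <= cmod (z - w) + cmod (w - t).
Proof. by rewrite (_ : z - t = (z - w) + (w - t)) ?cmodD//; ring. Qed.

Lemma cmodBD z w : cmod (z - w) <= cmod z + cmod w.
Proof. by rewrite -(cmodN w) cmodD. Qed.

Lemma cmod_sub_le z w : cmod z - cmod w <= cmod (z - w).
Proof. by rewrite lerBlDr -{1}(subrK w z) cmodD. Qed.

Lemma cmod_real x : cmod (Complex x 0) = `|x|.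
Proof. by rewrite /cmod /= expr0n /= addr0 sqrtr_sqr. Qed.

Lemma cmod_sqr z : cmod z ^+ 2 = complex.Re z ^+ 2 + complex.Im z ^+ 2.
Proof. by rewrite /cmod sqr_sqrtr// addr_ge0// sqr_ge0. Qed.

Lemma cmod_Re z : `|complex.Re z| <= cmod z.
Proof. by rewrite /cmod -sqrtr_sqr ler_wsqrtr// lerDl sqr_ge0. Qed.

Lemma cmod_Im z : `|complex.Im z| <= cmod z.
Proof. by rewrite /cmod -sqrtr_sqr ler_wsqrtr// lerDr sqr_ge0. Qed.

Lemma cmod_le_ReIm z : cmod z <= `|complex.Re z| + `|complex.Im z|.
Proof.
rewrite /cmod -(@ger0_norm _ (`|_| + _)) ?addr_ge0// -sqrtr_sqr ler_wsqrtr//.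
rewrite -[complex.Re z ^+ 2]real_normK ?num_real//.
rewrite -[complex.Im z ^+ 2]real_normK ?num_real//.
have := mulr_ge0 (normr_ge0 (complex.Re z)) (normr_ge0 (complex.Im z)); nra.
Qed.

Lemma cReD z w : complex.Re (z + w) = complex.Re z + complex.Re w.
Proof. by case: z; case: w. Qed.

Lemma cReB z w : complex.Re (z - w) = complex.Re z - complex.Re w.
Proof. by case: z; case: w. Qed.

Lemma cReM z w : complex.Re (z * w) =
  complex.Re z * complex.Re w - complex.Im z * complex.Im w.
Proof. by case: z; case: w. Qed.

Lemma cImD z w : complex.Im (z + w) = complex.Im z + complex.Im w.
Proof. by case: z; case: w. Qed.

Lemma cImB z w : complex.Im (z - w) = complex.Im z - complex.Im w.
Proof. by case: z; case: w. Qed.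

Lemma cImM z w : complex.Im (z * w) =
  complex.Re z * complex.Im w + complex.Im z * complex.Re w.
Proof. by case: z; case: w. Qed.

Lemma complex_ReIm z : Complex (complex.Re z) (complex.Im z) = z.
Proof. by case: z. Qed.

End ComplexModulus.

Section ComplexDifferentiation.
Variable R : realType.
Local Notation C := R[i].
Implicit Types (f g : C -> C) (z w : C).

Definition ccontinuous f z := forall e : R, 0 < e -> exists2 d : R, 0 < d &
  forall h, cmod h < d -> cmod (f (z + h) - f z) < e.

Lemma ccontinuous_cst c z : ccontinuous (fun=> c) z.
Proof. by move=> e e0; exists 1 => // h _; rewrite subrr cmod0. Qed.

Lemma ccontinuous_id z : ccontinuous id z.
Proof. by move=> e e0; exists e => // h; rewrite addrC addKr. Qed.

Lemma ccontinuousD f g z : ccontinuous f z -> ccontinuous g z ->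
  ccontinuous (fun x => f x + g x) z.
Proof.
move=> cf cg e e0; have e2 : 0 < e / 2 by rewrite divr_gt0.
have [d1 d10 h1] := cf _ e2; have [d2 d20 h2] := cg _ e2.
exists (Num.min d1 d2) => [|h]; first by rewrite lt_min d10.
rewrite lt_min => /andP[/h1 hf /h2 hg].
rewrite (_ : _ - _ = (f (z + h) - f z) + (g (z + h) - g z)); last by ring.
by rewrite (le_lt_trans (cmodD _ _))// (splitr e) ltrD.
Qed.

Lemma ccontinuousM f g z : ccontinuous f z -> ccontinuous g z ->
  ccontinuous (fun x => f x * g x) z.
Proof.
move=> cf cg e e0.
pose K := 1 + cmod (f z) + cmod (g z).
have K0 : 0 < K by rewrite /K -addrA ltr_wpDr// addr_ge0// cmod_ge0.
have e'0 : 0 < Num.min 1 (e / K) by rewrite lt_min ltr01 divr_gt0.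
have [d1 d10 h1] := cf _ e'0; have [d2 d20 h2] := cg _ e'0.
exists (Num.min d1 d2) => [|h]; first by rewrite lt_min d10.
rewrite lt_min => /andP[/h1 hf /h2 hg].
set a := f (z + h) - f z in hf *; set b := g (z + h) - g z in hg *.
have -> : f (z + h) * g (z + h) - f z * g z = a * b + f z * b + a * g z.
  by rewrite /a /b; ring.
apply: le_lt_trans (cmodD _ _) _.
apply: le_lt_trans (lerD (cmodD _ _) (lexx _)) _.
rewrite !cmodM.
move: hf hg; rewrite !lt_min => /andP[a1 aK] /andP[b1 bK].
have : Num.max (cmod a) (cmod b) < e / K by rewrite gt_max aK bK.
rewrite ltr_pdivlMr// => mK; apply: le_lt_trans mK.
have am : cmod a <= Num.max (cmod a) (cmod b) by rewrite le_max lexx.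
have bm : cmod b <= Num.max (cmod a) (cmod b) by rewrite le_max lexx orbT.
rewrite /K !mulrDr mulr1 lerD//; last by rewrite ler_wpM2r// cmod_ge0.
rewrite lerD//; last by rewrite mulrC ler_wpM2r// cmod_ge0.
by rewrite (le_trans _ bm)// ler_piMl ?cmod_ge0// ltW.
Qed.

Lemma ccontinuousV f z : f z != 0 -> ccontinuous f z ->
  ccontinuous (fun x => (f x)^-1) z.
Proof.
move=> fz0 cf e e0; set m := cmod (f z).
have m0 : 0 < m by rewrite cmod_gt0.
have e'0 : 0 < Num.min (m / 2) (e * m ^+ 2 / 2).
  by rewrite lt_min !divr_gt0// mulr_gt0// exprn_gt0.
have [d d0 hd] := cf _ e'0; exists d => // h /hd.
rewrite lt_min => /andP[h1 h2].
have fh : m / 2 < cmod (f (z + h)).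
  have := cmod_sub_le (f z) (f (z + h)); rewrite cmodB -/m; lra.
have fh0 : f (z + h) != 0 by rewrite -cmod_gt0 (lt_trans _ fh)// divr_gt0.
have -> : (f (z + h))^-1 - (f z)^-1 = - (f (z + h) - f z) / (f (z + h) * f z).
  by field; rewrite fz0 fh0.
rewrite cmodM cmodV cmodN cmodM -/m ltr_pdivrMr; last first.
  by rewrite mulr_gt0// cmod_gt0.
apply: lt_le_trans h2 _.
rewrite (_ : e * m ^+ 2 / 2 = e * (m / 2 * m)); last by field.
by apply: ler_wpM2l; [exact: ltW|rewrite ler_wpM2r// ltW].
Qed.

Lemma ccontinuous_comp f g z : ccontinuous g z -> ccontinuous f (g z) ->
  ccontinuous (fun x => f (g x)) z.
Proof.
move=> cg cf e /cf[d1 /cg[d d0 hd] hf]; exists d => // h /hd /hf.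
by rewrite addrCA subrr addr0.
Qed.

(** Caratheodory's form of the derivative: with a factor [phi] continuous at [0], the rules for
    products, inverses and compositions become algebraic identities. *)
Lemma cderivableP f z : cderivable f z <->
  exists phi : C -> C, ccontinuous phi 0 /\ forall h, f (z + h) = f z + h * phi h.
Proof.
split=> [[L hL]|[phi [cphi fE]]].
  exists (fun h => if h == 0 then L else (f (z + h) - f z) / h); split; last first.
    move=> h; have [->|h0] := eqVneq h 0; first by rewrite mul0r !addr0.
    by field.
  move=> e e0; have [d d0 hd] := hL _ e0; exists d => // h hlt.
  rewrite add0r eqxx; have [_|h0] := eqVneq h 0; first by rewrite subrr cmod0.
  by apply: hd; rewrite hlt cmod_gt0 h0.
exists (phi 0) => e /cphi[d d0 hd]; exists d => // h /andP[h0 /hd].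
rewrite add0r fE; congr (cmod (_ - _) < _).
by rewrite cmod_gt0 in h0; field.
Qed.

Lemma cderivable_continuous f z : cderivable f z -> ccontinuous f z.
Proof.
case/cderivableP => phi [cphi fE].
have c : ccontinuous (fun h => f z + h * phi h) 0.
  apply: ccontinuousD; first exact: ccontinuous_cst.
  by apply: ccontinuousM => //; exact: ccontinuous_id.
move=> e /c[d d0 hd]; exists d => // h /hd.
by rewrite add0r mul0r addr0 fE.
Qed.

Lemma cderivable_cst c z : cderivable (fun=> c) z.
Proof.
apply/cderivableP; exists (fun=> 0); split; first exact: ccontinuous_cst.
by move=> h; rewrite mulr0 addr0.
Qed.

Lemma cderivable_id z : cderivable id z.
Proof.
apply/cderivableP; exists (fun=> 1); split; first exact: ccontinuous_cst.
by move=> h; rewrite mulr1.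
Qed.

Lemma cderivableD f g z : cderivable f z -> cderivable g z ->
  cderivable (fun x => f x + g x) z.
Proof.
move=> /cderivableP[p [cp pE]] /cderivableP[q [cq qE]]; apply/cderivableP.
exists (fun h => p h + q h); split; first exact: ccontinuousD.
by move=> h; rewrite pE qE; ring.
Qed.

Lemma cderivableM f g z : cderivable f z -> cderivable g z ->
  cderivable (fun x => f x * g x) z.
Proof.
move=> /cderivableP[p [cp pE]] dg.
have /cderivableP[q [cq qE]] := dg; apply/cderivableP.
exists (fun h => p h * (g z + h * q h) + f z * q h); split; last first.
  by move=> h; rewrite pE qE; ring.
apply: ccontinuousD; last by apply: ccontinuousM => //; exact: ccontinuous_cst.
apply: ccontinuousM => //; apply: ccontinuousD; first exact: ccontinuous_cst.
by apply: ccontinuousM => //; exact: ccontinuous_id.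
Qed.

Lemma cderivableV f z : f z != 0 -> cderivable f z ->
  cderivable (fun x => (f x)^-1) z.
Proof.
move=> fz0 df; have cf := cderivable_continuous df.
have /cderivableP[p [cp pE]] := df.
(* The factorization must hold for every [h], also where [f (z + h)] vanishes and its inverse is [0]
   by convention; the first branch is the value forced there. Continuity of [f] keeps that branch
   away from [h = 0]. *)
apply/cderivableP; exists (fun h => if f (z + h) == 0 then - (f z)^-1 / h
  else - p h / (f (z + h) * f z)); split; last first.
  move=> h; case: ifPn => [/eqP fh0|fh0].
    have h0 : h != 0.
      by apply: contraNneq fz0 => h0; rewrite -fh0 h0 addr0.
    by rewrite fh0 invr0; field; rewrite h0 fz0.
  by rewrite pE in fh0 *; field; rewrite fh0 fz0.
have c : ccontinuous (fun h => - p h / (f (z + h) * f z)) 0.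
  apply: ccontinuousM.
    rewrite (_ : (fun _ => _) = (fun h => -1 * p h)).
      by apply: ccontinuousM => //; exact: ccontinuous_cst.
    by apply/funext => h; rewrite mulN1r.
  apply: ccontinuousV; first by rewrite addr0 mulf_neq0.
  apply: ccontinuousM; last exact: ccontinuous_cst.
  by move=> e' /cf[d d0 hd]; exists d => // h /hd; rewrite add0r addr0.
have m0 : 0 < cmod (f z) by rewrite cmod_gt0.
have [d1 d10 hd1] := cf _ m0.
move=> e /c[d2 d20 hd2].
exists (Num.min d1 d2) => [|h]; first by rewrite lt_min d10.
rewrite lt_min => /andP[/hd1 hh1 /hd2].
rewrite !add0r addr0 (negbTE fz0); case: ifPn => // /eqP fh0.
by rewrite fh0 sub0r cmodN ltxx in hh1.
Qed.

Lemma cderivable_comp f g z : cderivable g z -> cderivable f (g z) ->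
  cderivable (fun x => f (g x)) z.
Proof.
move=> /cderivableP[p [cp pE]] /cderivableP[q [cq qE]]; apply/cderivableP.
exists (fun h => p h * q (h * p h)); split; last first.
  by move=> h; rewrite pE qE; ring.
apply: ccontinuousM => //; apply: ccontinuous_comp.
  by apply: ccontinuousM => //; exact: ccontinuous_id.
by rewrite mul0r.
Qed.

Lemma cderivableX n z : cderivable (fun x : C => x ^+ n) z.
Proof.
elim: n => [|n IH]; first exact: cderivable_cst.
rewrite (_ : (fun _ => _) = (fun x => x * x ^+ n)); last first.
  by apply/funext => x; rewrite exprS.
by apply: cderivableM => //; exact: cderivable_id.
Qed.

Lemma ccontinuous_real f (t : R) : ccontinuous f (Complex t 0) ->
  {for t, continuous (fun s : R => complex.Re (f (Complex s 0)))} /\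
  {for t, continuous (fun s : R => complex.Im (f (Complex s 0)))}.
Proof.
move=> cf; split; apply/cvgrPdist_lt => e /cf[d d0 hd]; near=> s.
  have -> : Complex s 0 = Complex t 0 + Complex (s - t) 0 :> C.
    by apply/eqP; rewrite eq_complex /= addr0 eqxx andbT; apply/eqP; ring.
  rewrite distrC -cReB; apply: le_lt_trans (cmod_Re _) _; apply: hd.
  rewrite cmod_real distrC; near: s; by apply: cvgr_dist_lt d0.
have -> : Complex s 0 = Complex t 0 + Complex (s - t) 0 :> C.
  by apply/eqP; rewrite eq_complex /= addr0 eqxx andbT; apply/eqP; ring.
rewrite distrC -cImB; apply: le_lt_trans (cmod_Im _) _; apply: hd.
rewrite cmod_real distrC; near: s; by apply: cvgr_dist_lt d0.
Unshelve. all: by end_near. Qed.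

End ComplexDifferentiation.

(** * Goursat's lemma *)

Section Goursat.
Variable R : realType.
Local Notation I f a b := (Rintegral (@lebesgue_measure R) `[a, b] f).

Let continuous_itv (f : R -> R) (a b : R) :=
  forall x, a <= x <= b -> {for x, continuous f}.

Lemma integrable_continuous_itv (f : R -> R) (a b : R) :
  continuous_itv f a b ->
  (@lebesgue_measure R).-integrable `[a, b] (EFin \o f).
Proof.
move=> cf; apply: continuous_compact_integrable; first exact: segment_compact.
by apply: continuous_in_subspaceT => x; rewrite inE /= in_itv /=; exact: cf.
Qed.

Lemma Rintegral_itv_split (f : R -> R) (a m b : R) : a <= m -> m <= b ->
  continuous_itv f a b -> I f a b = I f a m + I f m b.
Proof.
move=> am mb cf; have intf := integrable_continuous_itv cf.
have := @Rintegral_itvB R f (BLeft a) (BRight b) m intf.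
rewrite !bnd_simp am mb => /(_ isT isT) E.
rewrite -[I f m b]Rintegral_itv_obnd_cbnd; first by rewrite -E; ring.
by apply: integrableS intf => //; apply: subset_itv; rewrite bnd_simp.
Qed.

Lemma Rintegral_itv_approx (f : R -> R) (a b k e : R) : a <= b ->
  continuous_itv f a b -> (forall x, a <= x <= b -> `|f x - k| <= e) ->
  `|I f a b - k * (b - a)| <= e * (b - a).
Proof.
move=> ab cf fk; have intf := integrable_continuous_itv cf.
have intc (c : R) : (@lebesgue_measure R).-integrable `[a, b] (EFin \o cst c).
  by apply: integrable_continuous_itv => x _; exact: cst_continuous.
have cstE (c : R) : I (cst c) a b = c * (b - a).
  rewrite Rintegral_cst//= lebesgue_measure_itv /= lte_fin.
  by case: ltP => //= ba; rewrite (_ : b = a) ?subrr//; apply/eqP; rewrite eq_le ba ab.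
have h1 : I f a b <= I (cst (k + e)) a b.
  apply: le_Rintegral => //; first exact: (intc (k + e)).
  move=> x; rewrite /= in_itv /= => /fk.
  by rewrite ler_norml => /andP[_]; rewrite lerBlDl.
have h2 : I (cst (k - e)) a b <= I f a b.
  apply: le_Rintegral => //; first exact: (intc (k - e)).
  move=> x; rewrite /= in_itv /= => /fk.
  by rewrite ler_norml => /andP[+ _]; rewrite lerBrDl.
move: h1 h2; rewrite !cstE ler_norml; move: (I f a b) => J h1 h2.
by clear -h1 h2; apply/andP; split; lra.
Qed.

Lemma nested_itv_point (lo up : nat -> R) :
  (forall n, lo n <= lo n.+1) -> (forall n, up n.+1 <= up n) ->
  (forall n, lo n <= up n) -> exists x, forall n, lo n <= x <= up n.
Proof.
move=> hlo hup lu.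
have mlo : {homo lo : m n / (m <= n)%N >-> m <= n}.
  by apply: homo_leq => // y x z; exact: le_trans.
have mup : {homo up : m n / (m <= n)%N >-> n <= m}.
  by apply: homo_leq => // y x z h1 h2; exact: le_trans h2 h1.
have key m n : lo m <= up n.
  apply: le_trans (mlo _ _ (leq_maxl m n)) _.
  exact: le_trans (lu _) (mup _ _ (leq_maxr m n)).
exists (sup (range lo)) => n; apply/andP; split.
  apply: sup_ubound; last by exists n.
  by exists (up 0%N) => _ [m _ <-].
by apply: ge_sup; [exists (lo 0%N); exists 0%N|move=> _ [m _ <-]].
Qed.

Variables P Q : R -> R -> R.

(** The form [P dx + Q dy] is differentiable and closed at the point: [be] is at once the derivative
    of [P] in [y] and of [Q] in [x]. Nothing is said about continuity of the partial derivatives. *)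
Definition closed_form_at (x y : R) := exists al be ga : R,
  forall e, 0 < e -> exists2 d, 0 < d & forall u v, `|u| < d -> `|v| < d ->
    `|P (x + u) (y + v) - P x y - (al * u + be * v)| <= e * (`|u| + `|v|) /\
    `|Q (x + u) (y + v) - Q x y - (be * u + ga * v)| <= e * (`|u| + `|v|).

Lemma affine_bound_continuous (f : R -> R) (x k : R) :
  (exists2 d, 0 < d & forall u, `|u| < d -> `|f (x + u) - f x - k * u| <= `|u|) ->
  {for x, continuous f}.
Proof.
case=> d d0 hd; apply/cvgrPdist_lt => e e0; near=> t.
have td : `|t - x| < Num.min d (e / (`|k| + 1)).
  rewrite distrC; near: t; apply: cvgr_dist_lt => //.
  by rewrite lt_min d0 divr_gt0// ltr_wpDl.
move: td; rewrite lt_min ltr_pdivlMr ?ltr_wpDl// => /andP[t1 t2].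
have := hd _ t1; rewrite [x + _]addrCA subrr addr0 => h.
rewrite distrC (_ : f t - f x = (f t - f x - k * (t - x)) + k * (t - x)); last by ring.
apply: le_lt_trans (ler_normD _ _) _; rewrite normrM.
by apply: le_lt_trans t2; rewrite [leRHS]mulrDr mulr1 [leRHS]addrC lerD// mulrC.
Unshelve. all: by end_near. Qed.

Lemma closed_form_continuous x y : closed_form_at x y ->
  [/\ {for x, continuous (P^~ y)}, {for x, continuous (Q^~ y)},
      {for y, continuous (P x)} & {for y, continuous (Q x)}].
Proof.
move=> [al [be [ga /(_ _ ltr01)[d d0 hd]]]].
split; [apply: (@affine_bound_continuous _ _ al)|apply: (@affine_bound_continuous _ _ be)
  |apply: (@affine_bound_continuous _ _ be)|apply: (@affine_bound_continuous _ _ ga)];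
  exists d => // u ud.
- have [] := hd u 0 ud; rewrite ?normr0//.
  by rewrite !addr0 mulr0 addr0 mul1r.
- have [] := hd u 0 ud; rewrite ?normr0//.
  by rewrite !addr0 !mulr0 !addr0 mul1r.
- have [] := hd 0 u _ ud; rewrite ?normr0//.
  by rewrite !addr0 !mulr0 !add0r mul1r.
- have [] := hd 0 u _ ud; rewrite ?normr0//.
  by rewrite !addr0 !mulr0 !add0r mul1r.
Qed.

(** The integral of [P dx + Q dy] counterclockwise around the rectangle with sides [[a, b]] and
    [[c, d]], opposite edges being paired. *)
Definition circulation a b c d : R :=
  I (fun x => P x c - P x d) a b + I (fun y => Q b y - Q a y) c d.

Section Rectangle.
Variables A B D E : R.
Hypothesis PQ : forall x y, A <= x <= B -> D <= y <= E -> closed_form_at x y.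

Let contP y y' : D <= y <= E -> D <= y' <= E ->
  continuous_itv (fun x => P x y - P x y') A B.
Proof.
move=> hy hy' x hx; apply: continuousB.
  by have [] := closed_form_continuous (PQ hx hy).
by have [] := closed_form_continuous (PQ hx hy').
Qed.

Let contQ x x' : A <= x <= B -> A <= x' <= B ->
  continuous_itv (fun y => Q x y - Q x' y) D E.
Proof.
move=> hx hx' y hy; apply: continuousB.
  by have [] := closed_form_continuous (PQ hx hy).
by have [] := closed_form_continuous (PQ hx' hy).
Qed.

Let sub_itv (f : R -> R) a b a' b' : a <= a' -> b' <= b ->
  continuous_itv f a b -> continuous_itv f a' b'.
Proof.
move=> aa bb cf x /andP[x1 x2]; apply: cf.
by rewrite (le_trans aa)// (le_trans x2).
Qed.

(** Each inner edge is run through twice in opposite directions, so its contributions cancel. *)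
Lemma circulation_quarters a b c d m n :
  A <= a -> a <= m -> m <= b -> b <= B ->
  D <= c -> c <= n -> n <= d -> d <= E ->
  circulation a b c d = circulation a m c n + circulation m b c n
    + (circulation a m n d + circulation m b n d).
Proof.
move=> Aa am mb bB Dc cn nd dE.
have Am := le_trans Aa am; have mB := le_trans mb bB.
have Ab := le_trans Am mb; have aB := le_trans am mB.
have Dn := le_trans Dc cn; have nE := le_trans nd dE.
have Dd := le_trans Dn nd; have cE := le_trans cn nE.
have inA x : A <= x -> x <= B -> A <= x <= B by move=> -> ->.
have inD x : D <= x -> x <= E -> D <= x <= E by move=> -> ->.
have cP y y' a' b' : D <= y -> y <= E -> D <= y' -> y' <= E ->
   A <= a' -> b' <= B -> continuous_itv (fun x => P x y - P x y') a' b'.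
  by move=> *; apply: (sub_itv (a := A) (b := B)) => //; apply: contP; exact: inD.
have cQ x x' c' d' : A <= x -> x <= B -> A <= x' -> x' <= B ->
   D <= c' -> d' <= E -> continuous_itv (fun y => Q x y - Q x' y) c' d'.
  by move=> *; apply: (sub_itv (a := D) (b := E)) => //; apply: contQ; exact: inA.
have addP a' b' : A <= a' -> b' <= B -> I (fun x => P x c - P x d) a' b' =
    I (fun x => P x c - P x n) a' b' + I (fun x => P x n - P x d) a' b'.
  move=> ? ?; rewrite -RintegralD//.
  - by congr Rintegral; apply/funext => x; ring.
  - by apply: integrable_continuous_itv; exact: cP.
  - by apply: integrable_continuous_itv; exact: cP.
have addQ c' d' : D <= c' -> d' <= E -> I (fun y => Q b y - Q a y) c' d' =
    I (fun y => Q m y - Q a y) c' d' + I (fun y => Q b y - Q m y) c' d'.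
  move=> ? ?; rewrite -RintegralD//.
  - by congr Rintegral; apply/funext => y; ring.
  - by apply: integrable_continuous_itv; exact: cQ.
  - by apply: integrable_continuous_itv; exact: cQ.
rewrite /circulation (Rintegral_itv_split am mb); last exact: cP.
rewrite (Rintegral_itv_split cn nd); last exact: cQ.
by rewrite !addP// !addQ//; ring.
Qed.

(** The affine part of the form contributes [- be * (d - c) * (b - a)] on the horizontal edges and
    the opposite on the vertical ones. Only the errors remain, at most [e] times the half-perimeter
    on each edge, with two edges in each integral. *)
Lemma circulation_small a b c d x y (al be ga e dl : R) :
  (forall u v, `|u| < dl -> `|v| < dl ->
    `|P (x + u) (y + v) - P x y - (al * u + be * v)| <= e * (`|u| + `|v|) /\
    `|Q (x + u) (y + v) - Q x y - (be * u + ga * v)| <= e * (`|u| + `|v|)) ->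
  0 < e ->
  A <= a -> a <= x -> x <= b -> b <= B -> D <= c -> c <= y -> y <= d -> d <= E ->
  b - a < dl -> d - c < dl ->
  `|circulation a b c d| <= 2 * e * ((b - a) + (d - c)) ^+ 2.
Proof.
move=> H e0 Aa ax xb bB Dc cy yd dE wd hd.
have ab := le_trans ax xb; have cd := le_trans cy yd.
have Ab := le_trans Aa ab; have aB := le_trans ab bB.
have Dd := le_trans Dc cd; have cE := le_trans cd dE.
have near_x t : a <= t <= b -> `|t - x| <= b - a.
  by move=> /andP[? ?]; rewrite ler_norml; apply/andP; split; lra.
have near_y t : c <= t <= d -> `|t - y| <= d - c.
  by move=> /andP[? ?]; rewrite ler_norml; apply/andP; split; lra.
have cc : c <= c <= d by rewrite lexx.
have dd : c <= d <= d by rewrite lexx cd.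
have aa : a <= a <= b by rewrite lexx.
have bb : a <= b <= b by rewrite lexx ab.
have est t s : a <= t <= b -> c <= s <= d ->
   `|P t s - P x y - (al * (t - x) + be * (s - y))| <= e * ((b - a) + (d - c)) /\
   `|Q t s - Q x y - (be * (t - x) + ga * (s - y))| <= e * ((b - a) + (d - c)).
  move=> /near_x ht /near_y hs.
  have [] := H _ _ (le_lt_trans ht wd) (le_lt_trans hs hd).
  rewrite !(addrC x) !(addrC y) !subrK => h1 h2.
  have le1 : e * (`|t - x| + `|s - y|) <= e * ((b - a) + (d - c)).
    by rewrite ler_pM2l// lerD.
  by split; [exact: le_trans h1 le1|exact: le_trans h2 le1].
have h1 : `|I (fun t => P t c - P t d) a b - (- be * (d - c)) * (b - a)| <=
    2 * e * ((b - a) + (d - c)) * (b - a).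
  apply: Rintegral_itv_approx => //.
    apply: (sub_itv Aa bB); apply: contP; rewrite ?Dc ?cE ?Dd//.
  move=> t ht; have [+ _] := est t c ht cc; have [+ _] := est t d ht dd.
  rewrite !ler_norml => /andP[? ?] /andP[? ?]; apply/andP; split; nra.
have h2 : `|I (fun s => Q b s - Q a s) c d - (be * (b - a)) * (d - c)| <=
    2 * e * ((b - a) + (d - c)) * (d - c).
  apply: Rintegral_itv_approx => //.
    apply: (sub_itv Dc dE); apply: contQ; rewrite ?Aa ?aB ?Ab//.
  move=> t ht; have [_] := est b t bb ht; have [_] := est a t aa ht.
  rewrite !ler_norml => /andP[? ?] /andP[? ?]; apply/andP; split; nra.
rewrite /circulation; set i1 := I _ _ _ in h1 *; set i2 := I _ _ _ in h2 *.
rewrite (_ : i1 + i2 = (i1 - - be * (d - c) * (b - a)) + (i2 - be * (b - a) * (d - c)));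
  last by ring.
apply: le_trans (ler_normD _ _) _; apply: le_trans (lerD h1 h2) _.
by rewrite -mulrDr expr2 mulrA.
Qed.

(** Repeated quartering keeps a rectangle that carries at least a quarter of the previous
    circulation. At the common point [(x, y)] the bound of [circulation_small] also shrinks by [4]
    at each step, so the factors cancel and an arbitrary [e] bounds the original circulation. *)
Lemma goursat : A <= B -> D <= E -> circulation A B D E = 0.
Proof.
move=> AB DE.
pose w n : R := (B - A) / 2 ^+ n; pose h n : R := (E - D) / 2 ^+ n.
have pow0 n : 0 < 2 ^+ n :> R by rewrite exprn_gt0.
have w0 n : 0 <= w n by rewrite divr_ge0 ?subr_ge0// ltW.
have h0 n : 0 <= h n by rewrite divr_ge0 ?subr_ge0// ltW.
have wS n : w n = w n.+1 + w n.+1.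
  by rewrite /w exprS; field; rewrite gt_eqF.
have hS n : h n = h n.+1 + h n.+1.
  by rewrite /h exprS; field; rewrite gt_eqF.
have four (p q r s : R) : 4 * `|p| < `|p + q + (r + s)| ->
    4 * `|q| < `|p + q + (r + s)| -> 4 * `|r| < `|p + q + (r + s)| ->
    4 * `|s| < `|p + q + (r + s)| -> False.
  have := ler_normD (p + q) (r + s); have := ler_normD p q.
  by have := ler_normD r s; lra.
pose T n (p : R * R) := circulation p.1 (p.1 + w n) p.2 (p.2 + h n).
pose S n (p : R * R) := [/\ A <= p.1, p.1 + w n <= B, D <= p.2 & p.2 + h n <= E].
(* The premise [S] sits inside the existential so that [choice] gives a successor for every pair;
   where [S] fails the value is a dummy. *)
have step (np : nat * (R * R)) : exists q : R * R, S np.1 np.2 ->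
    [/\ S np.1.+1 q, np.2.1 <= q.1 /\ q.1 + w np.1.+1 <= np.2.1 + w np.1,
      np.2.2 <= q.2 /\ q.2 + h np.1.+1 <= np.2.2 + h np.1 &
      `|T np.1 np.2| <= 4 * `|T np.1.+1 q|].
  case: np => n [a c] /=.
  have [[Aa aB Dc cE]|] := pselect (S n (a, c)); last by exists (0, 0).
  rewrite /= in Aa aB Dc cE; have w1 := w0 n.+1; have h1 := h0 n.+1.
  have := @circulation_quarters a (a + w n) c (c + h n) (a + w n.+1) (c + h n.+1).
  rewrite Aa aB Dc cE (wS n) (hS n) (addrA a) (addrA c) !lerDl w1 h1.
  move=> /(_ isT isT isT isT isT isT isT isT) quarters.
  have : exists2 q, (q.1 = a \/ q.1 = a + w n.+1) /\ (q.2 = c \/ q.2 = c + h n.+1) &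
      `|T n (a, c)| <= 4 * `|T n.+1 q|.
    apply: contrapT => /forall2NP no.
    have lt4 q : (q.1 = a \/ q.1 = a + w n.+1) /\ (q.2 = c \/ q.2 = c + h n.+1) ->
      4 * `|T n.+1 q| < `|T n (a, c)|.
      by move=> hq; have [/(_ hq)//|/negP] := no q; rewrite -ltNge.
    have := lt4 (a, c); have := lt4 (a + w n.+1, c).
    have := lt4 (a, c + h n.+1); have := lt4 (a + w n.+1, c + h n.+1).
    move=> /(_ (conj (or_intror erefl) (or_intror erefl))) l1.
    move=> /(_ (conj (or_introl erefl) (or_intror erefl))) l2.
    move=> /(_ (conj (or_intror erefl) (or_introl erefl))) l3.
    move=> /(_ (conj (or_introl erefl) (or_introl erefl))) l4.
    move: l1 l2 l3 l4; rewrite /T /= (wS n) (hS n) (addrA a) (addrA c) quarters => l1 l2 l3 l4.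
    exact: four l4 l3 l2 l1.
  case=> -[x y] /= [hx hy] hT; exists (x, y) => _.
  move: hx hy => /= hx hy; have ww := wS n; have hh := hS n.
  split => //=.
  - by split => /=; case: hx => ?; case: hy => ?; lra.
  - by split; case: hx => ?; lra.
  - by split; case: hy => ?; lra.
have [nx hnx] := choice step.
pose pt := nat_rect (fun=> (R * R)%type) (A, D) (fun n p => nx (n, p)).
have ptS n : S n (pt n).
  elim: n => [|n IH]; last by have [] := hnx (n, pt n) IH.
  by rewrite /S /w /h expr0 !divr1 !(addrC _ (_ - _)) !subrK !lexx.
have Tpt n : `|T 0%N (A, D)| <= 4 ^+ n * `|T n (pt n)|.
  elim: n => [|n IH]; first by rewrite expr0 mul1r.
  have [_ _ _ hT] := hnx (n, pt n) (ptS n).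
  by apply: le_trans IH _; rewrite exprSr -mulrA ler_pM2l ?exprn_gt0.
have [x hx] : exists x, forall n, (pt n).1 <= x <= (pt n).1 + w n.
  apply: nested_itv_point => n; last by rewrite lerDl.
    by have [_ []] := hnx (n, pt n) (ptS n).
  by have [_ []] := hnx (n, pt n) (ptS n).
have [y hy] : exists y, forall n, (pt n).2 <= y <= (pt n).2 + h n.
  apply: nested_itv_point => n; last by rewrite lerDl.
    by have [_ _ []] := hnx (n, pt n) (ptS n).
  by have [_ _ []] := hnx (n, pt n) (ptS n).
have xAB : A <= x <= B.
  by have := hx 0%N; rewrite /w expr0 divr1 /= addrC subrK.
have yDE : D <= y <= E.
  by have := hy 0%N; rewrite /h expr0 divr1 /= addrC subrK.
have [al [be [ga H]]] := PQ xAB yDE.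
apply/eqP; rewrite -normr_le0; apply/ler_addgt0Pr => e e0; rewrite add0r.
(* The constant of [circulation_small] for the whole rectangle, plus [1] so that dividing by it is
   safe for a degenerate one. *)
pose K := 2 * ((B - A) + (E - D)) ^+ 2 + 1.
have K0 : 0 < K by rewrite ltr_wpDl// mulr_ge0// sqr_ge0.
have [dl dl0 hdl] := H _ (divr_gt0 e0 K0).
have [n hn] : exists n, w n < dl /\ h n < dl.
  have := @cvg_geometric R ((B - A) + (E - D)) 2^-1.
  rewrite gtr0_norm ?invr_gt0// invf_lt1// ltr1n => /(_ isT) /cvgrPdist_lt /(_ _ dl0).
  move=> [N _ /(_ N (leqnn N))].
  rewrite /= sub0r normrN ger0_norm; last first.
    by rewrite mulr_ge0 ?exprn_ge0 ?invr_ge0// addr_ge0 ?subr_ge0.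
  rewrite mulrDl exprVn => hN; exists N; have := w0 N; have := h0 N; rewrite /w /h; lra.
have [Aa aB Dc cE] := ptS n.
have /andP[x1 x2] := hx n; have /andP[y1 y2] := hy n.
have := @circulation_small _ _ _ _ x y al be ga _ _ hdl (divr_gt0 e0 K0)
  Aa x1 x2 aB Dc y1 y2 cE.
rewrite !(addrAC _ _ (- _)) !subrr !add0r => /(_ hn.1 hn.2) small.
have := Tpt n; rewrite {1}/T /= /w /h expr0 !divr1 !(addrC _ (_ - _)) !subrK.
move=> /le_trans; apply.
apply: le_trans (ler_wpM2l (exprn_ge0 _ (ler0n _ 4)) small) _.
rewrite /w /h -mulrDl expr_div_n -exprM mulnC exprM (_ : 2 ^+ 2 = 4 :> R); last by ring.
rewrite (_ : 4 ^+ n * _ = (2 * (B - A + (E - D)) ^+ 2) * (e / K)); last first.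
  by field; rewrite gt_eqF//= gt_eqF// exprn_gt0.
rewrite mulrCA ger_pMr// ler_pdivrMr// mul1r /K; lra.
Qed.

End Rectangle.
End Goursat.

(** * Maximum principle on annuli *)

Section MaximumPrinciple.
Variable R : realType.
Local Notation C := R[i].
Implicit Types (f g : C -> C) (z w : C).

Lemma is_derive_approx (f : R -> R) (x L : R) : is_derive x (1 : R) f L ->
  forall e, 0 < e -> exists2 d, 0 < d &
    forall u, `|u| < d -> `|f (x + u) - f x - L * u| <= e * `|u|.
Proof.
case=> df DL e e0.
have : (fun h : R => h^-1 *: ((f \o shift x) (h *: (1 : R)) - f x)) @ 0^' --> L.
  by rewrite -DL; exact: df.
move=> /cvgrPdist_lt /(_ _ e0) /nbhs_ballP[d /= d0 hd]; exists d => // u ud.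
have [->|u0] := eqVneq u 0; first by rewrite addr0 mulr0 subr0 subrr normr0 mulr0.
have := hd u; rewrite /ball /= sub0r normrN => /(_ ud u0).
rewrite /= /shift /= [_ *: 1]mulr1 (addrC u) => h.
rewrite (_ : _ - L * u = - (L - u^-1 * (f (x + u) - f x)) * u); last by field.
by rewrite normrM normrN ler_wpM2r// ltW.
Qed.

Definition cexp z : C := Complex (expR (complex.Re z) * cos (complex.Im z))
                                (expR (complex.Re z) * sin (complex.Im z)).

Lemma cexpD z w : cexp (z + w) = cexp z * cexp w.
Proof.
apply/eqP; rewrite eq_complex cReM cImM /= cReD cImD expRD cosD sinD.
by apply/andP; split; apply/eqP; ring.
Qed.

Lemma cmod_cexp z : cmod (cexp z) = expR (complex.Re z).
Proof.
rewrite /cmod /= !exprMn -mulrDr cos2Dsin2 mulr1 sqrtr_sqr.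
by rewrite gtr0_norm// expR_gt0.
Qed.

Lemma cderivable_cexp z : cderivable cexp z.
Proof.
rewrite (_ : cexp = fun x => cexp z * cexp (x - z)); last first.
  by apply/funext => x; rewrite -cexpD addrC subrK.
apply: cderivableM; first exact: cderivable_cst.
apply: (@cderivable_comp _ cexp (fun x => x - z)).
  by apply: cderivableD; [exact: cderivable_id|exact: cderivable_cst].
rewrite subrr; exists 1 => e e0.
(* The errors of the real and imaginary parts below add up to at most [9 * e' * cmod h], which the
   divisor [10] makes strictly smaller than [e * cmod h]. *)
have [e' [e'0 e'1 e'e]] : exists e', [/\ 0 < e', e' <= 1 & e' <= e / 10].
  exists (Num.min 1 (e / 10)).
  by rewrite lt_min ltr01 divr_gt0// !ge_min !lexx orbT.
have [d1 d10 hd1] := is_derive_approx (is_derive_expR (0 : R)) e'0.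
have [d2 d20 hd2] := is_derive_approx (is_derive_cos (0 : R)) e'0.
have [d3 d30 hd3] := is_derive_approx (is_derive_sin (0 : R)) e'0.
exists (Num.min e' (Num.min d1 (Num.min d2 d3))); first by rewrite !lt_min e'0 d10 d20.
move=> h; rewrite !lt_min cmod_gt0 => /and5P[h0 he h1 h2 h3].
have aR := cmod_Re h; have bI := cmod_Im h.
have := hd1 _ (le_lt_trans aR h1); have := hd2 _ (le_lt_trans bI h2).
have := hd3 _ (le_lt_trans bI h3).
rewrite !add0r expR0 cos0 sin0 oppr0 mul0r !mul1r !subr0 addr0 => hs hc hE.
have -> : (cexp h - cexp 0) / h - 1 = (cexp h - cexp 0 - h) / h by field.
rewrite cmodM cmodV ltr_pdivrMr ?cmod_gt0//.
apply: le_lt_trans (cmod_le_ReIm _) _; rewrite !cReB !cImB /= expR0 cos0 sin0 mul1r mulr0 subr0.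
set a := complex.Re h in aR hE *; set b := complex.Im h in bI hs hc *.
set Ea := expR a in hE *.
have Ea0 : 0 < Ea by exact: expR_gt0.
have a1 : `|a| <= e' by rewrite (le_trans aR)// ltW.
have Ea1 : `|Ea - 1| <= 2 * `|a|.
  rewrite (_ : Ea - 1 = (Ea - 1 - a) + a); last by ring.
  apply: le_trans (ler_normD _ _) _.
  have : e' * `|a| <= 1 * `|a| by rewrite ler_wpM2r.
  lra.
have Ea3 : Ea <= 3 by have := ler_norm (Ea - 1); lra.
have b0 := normr_ge0 b; have a0 := normr_ge0 a.
have re : `|Ea * cos b - 1 - a| <= e' * `|a| + 3 * (e' * `|b|).
  rewrite (_ : _ - a = (Ea - 1 - a) + Ea * (cos b - 1)); last by ring.
  apply: le_trans (ler_normD _ _) _; rewrite lerD// normrM (gtr0_norm Ea0).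
  by apply: ler_pM => //; exact: ltW.
have im : `|Ea * sin b - b| <= 3 * (e' * `|b|) + 2 * (e' * `|b|).
  rewrite (_ : _ - b = Ea * (sin b - b) + (Ea - 1) * b); last by ring.
  apply: le_trans (ler_normD _ _) _; rewrite !normrM (gtr0_norm Ea0) lerD//.
    by apply: ler_pM => //; exact: ltW.
  rewrite mulrA ler_wpM2r//; apply: le_trans Ea1 _; lra.
apply: le_lt_trans (lerD re im) _.
have hm : 0 < cmod h by rewrite cmod_gt0.
have h4 : e' * `|a| <= e / 10 * cmod h by apply: ler_pM => //; exact: ltW.
have h5 : e' * `|b| <= e / 10 * cmod h by apply: ler_pM => //; exact: ltW.
have h6 : 0 < e / 10 * cmod h by rewrite mulr_gt0// divr_gt0.
rewrite (_ : e * cmod h = 10 * (e / 10 * cmod h)); last by field.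
lra.
Qed.

(** The form is the imaginary part of [g dz]. By the Cauchy-Riemann equations both of its cross
    derivatives equal the real part of [L]. *)
Lemma cderivable_closed_form g x y : cderivable g (Complex x y) ->
  closed_form_at (fun x y => complex.Im (g (Complex x y)))
                 (fun x y => complex.Re (g (Complex x y))) x y.
Proof.
case=> L hL; exists (complex.Im L), (complex.Re L), (- complex.Im L) => e e0.
have [d d0 hd] := hL _ e0; exists (d / 2); first by rewrite divr_gt0.
move=> u v ud vd.
have := cmod_le_ReIm (Complex u v : C); set h : C := Complex u v => /= hm.
have key : cmod (g (Complex (x + u) (y + v)) - g (Complex x y) - L * h) <=
    e * (`|u| + `|v|).
  apply: le_trans (ler_wpM2l (ltW e0) hm).
  rewrite (_ : Complex (x + u) (y + v) = Complex x y + h)//.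
  have [->|h0] := eqVneq h 0; first by rewrite addr0 mulr0 subr0 subrr cmod0 mulr0.
  have hh : 0 < cmod h < d by rewrite cmod_gt0 h0 /=; lra.
  rewrite -ler_pdivrMr ?cmod_gt0// -cmodV -cmodM ltW//.
  rewrite (_ : (_ - _ - _) / h = (g (Complex x y + h) - g (Complex x y)) / h - L) ?hd//.
  by field.
split.
  apply: le_trans key; apply: le_trans _ (cmod_Im _).
  rewrite !cImB cImM /= (_ : _ + _ * v = complex.Re L * v + complex.Im L * u)//.
  by ring.
apply: le_trans key; apply: le_trans _ (cmod_Re _).
by rewrite !cReB cReM /= mulNr.
Qed.

Lemma Rintegral_itv_le (f : R -> R) (a b k : R) : a <= b ->
  (forall x, a <= x <= b -> {for x, continuous f}) ->
  (forall x, a <= x <= b -> f x <= k) ->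
  Rintegral (@lebesgue_measure R) `[a, b] f <= k * (b - a).
Proof.
move=> ab cf fk.
have -> : k * (b - a) = Rintegral (@lebesgue_measure R) `[a, b] (cst k).
  rewrite Rintegral_cst//= lebesgue_measure_itv /= lte_fin; case: ltP => //= ba.
  by rewrite (_ : b = a) ?subrr//; apply/eqP; rewrite eq_le ba ab.
apply: le_Rintegral => //; first exact: integrable_continuous_itv.
by apply: (@integrable_continuous_itv _ (cst k)) => x _; exact: cst_continuous.
Qed.

(** In the coordinates [z0 + cexp (x + i y)] circles around [z0] are vertical segments. [goursat] on
    [[s1, s2]] times [[0, 2 pi]], whose horizontal edges cancel by periodicity, says that the real
    part has the same mean on the circles of radii [expR s1] and [expR s2]. The small one has mean
    close to the value at [z0], the large one at most [B]. *)
Lemma Re_circle_max g z0 (r rho B : R) :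
  (forall z, cmod (z - z0) < r -> cderivable g z) -> 0 < rho < r ->
  (forall z, cmod (z - z0) = rho -> complex.Re (g z) <= B) ->
  complex.Re (g z0) <= B.
Proof.
move=> dg /andP[rho0 rhor] gB.
apply/ler_addgt0Pr => e e0.
have cg : ccontinuous g z0.
  by apply: cderivable_continuous; apply: dg; rewrite subrr cmod0 (lt_trans rho0).
have [d d0 hd] := cg _ e0.
(* The minimum ensures [s1 <= s2], and halving puts [expR s1] strictly below the radius [d] of
   continuity. *)
pose s2 := ln rho; pose s1 := ln (Num.min d rho / 2).
have m0 : 0 < Num.min d rho by rewrite lt_min d0.
have Es2 : expR s2 = rho by rewrite lnK// posrE.
have Es1 : expR s1 = Num.min d rho / 2 by rewrite lnK// posrE divr_gt0.
have Es1d : expR s1 < d.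
  by rewrite Es1; apply: lt_le_trans (_ : Num.min d rho <= d); [lra|rewrite ge_min lexx].
have s12 : s1 <= s2.
  rewrite -ler_expR Es1 Es2; apply: le_trans (_ : Num.min d rho <= rho); first by lra.
  by rewrite ge_min lexx orbT.
pose G := fun z => g (z0 + cexp z).
have dG x y : s1 <= x <= s2 -> cderivable G (Complex x y).
  move=> /andP[_ xs2]; apply: (@cderivable_comp _ g (fun z => z0 + cexp z)).
    by apply: cderivableD; [exact: cderivable_cst|exact: cderivable_cexp].
  by apply: dg; rewrite addrAC subrr add0r cmod_cexp /= (le_lt_trans _ rhor)// -Es2 ler_expR.
pose P x y := complex.Im (G (Complex x y)); pose Q x y := complex.Re (G (Complex x y)).
have cf x y : s1 <= x <= s2 -> closed_form_at P Q x y.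
  by move=> xs; apply: cderivable_closed_form; exact: dG.
have pi0 : 0 <= (pi : R) *+ 2 by rewrite mulrn_wge0// pi_ge0.
have := @goursat R P Q s1 s2 0 (pi *+ 2) (fun x y xs _ => cf x y xs) s12 pi0.
rewrite /circulation.
have -> : (fun x => P x 0 - P x (pi *+ 2)) = cst 0.
  by apply/funext => x; rewrite /P /G /cexp /= cos0 sin0 cos2pi sin2pi subrr.
rewrite Rintegral_cst//= mul0r add0r => I0.
have := @Rintegral_itv_le (fun y => Q s2 y - Q s1 y) 0 (pi *+ 2)
  (B - complex.Re (g z0) + e) pi0.
rewrite I0 subr0 pmulr_lge0; last by rewrite pmulrn_rgt0// pi_gt0.
move=> H; suff : 0 <= B - complex.Re (g z0) + e by lra.
apply: H => y _.
  apply: continuousB.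
    by have [] := @closed_form_continuous _ _ _ s2 y (cf s2 y _); rewrite ?s12 ?lexx.
  by have [] := @closed_form_continuous _ _ _ s1 y (cf s1 y _); rewrite ?s12 ?lexx.
have Q2 : Q s2 y <= B.
  by apply: gB; rewrite addrAC subrr add0r cmod_cexp /= Es2.
have Q1 : `|Q s1 y - complex.Re (g z0)| < e.
  rewrite -cReB; apply: le_lt_trans (cmod_Re _) _; apply: hd.
  by rewrite cmod_cexp.
by move: Q1; rewrite ltr_norml => /andP[? ?]; lra.
Qed.

(** Moves the continuity of the modulus to [R * R], where the annulus is treated as a compact
    set. *)
Lemma ccontinuous_pair f (p : R * R) : ccontinuous f (Complex p.1 p.2) ->
  {for p, continuous (fun q : R * R => cmod (f (Complex q.1 q.2)))}.
Proof.
move=> cf; apply/cvgrPdist_lt => e /cf[d d0 hd].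
have d2 : 0 < d / 2 by rewrite divr_gt0.
have /cvgrPdist_lt/(_ _ d2) n1 : (fun q : R * R => q.1) @ p --> p.1 by exact: cvg_fst.
have /cvgrPdist_lt/(_ _ d2) n2 : (fun q : R * R => q.2) @ p --> p.2 by exact: cvg_snd.
near=> q.
have h1 : `|p.1 - q.1| < d / 2 by near: q.
have h2 : `|p.2 - q.2| < d / 2 by near: q.
have {}hd : cmod (f (Complex q.1 q.2) - f (Complex p.1 p.2)) < e.
  have := hd (Complex (q.1 - p.1) (q.2 - p.2)).
  rewrite (_ : Complex p.1 p.2 + _ = Complex q.1 q.2); last first.
    by apply/eqP; rewrite eq_complex /=; apply/andP; split; apply/eqP; ring.
  apply; apply: le_lt_trans (cmod_le_ReIm _) _ => /=.
  by rewrite !(distrC q.1) (distrC q.2); lra.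
rewrite ltr_norml.
have := cmod_sub_le (f (Complex q.1 q.2)) (f (Complex p.1 p.2)).
have := cmod_sub_le (f (Complex p.1 p.2)) (f (Complex q.1 q.2)).
by rewrite (cmodB (f (Complex p.1 p.2))) => ? ?; apply/andP; split; lra.
Unshelve. all: by end_near. Qed.

(* Dividing by [K - |z|^2] makes the maximum principle strict: at an interior
   maximum [z1] of the quotient the holomorphic function
   [c g z + 2 psi conj(z1) z] violates [Re_circle_max]. *)
Lemma annulus_max g (r1 r2 M : R) z0 :
  (forall z, 0 < cmod z < 1 -> cderivable g z) ->
  0 < r1 -> r1 <= cmod z0 -> cmod z0 <= r2 -> r2 < 1 ->
  (forall z, cmod z = r1 \/ cmod z = r2 -> cmod (g z) <= M) ->
  cmod (g z0) <= M.
Proof.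
move=> dg r10 r1z zr2 r21 gM.
have M0 : 0 <= M.
  apply: le_trans (cmod_ge0 (g (Complex r1 0))) (gM _ _); left.
  by rewrite cmod_real gtr0_norm.
(* The maximum principle is obtained up to the factor [K / (K - 1)], which tends to [1] as [K]
   grows. *)
suff H K : 1 < K -> cmod (g z0) * (K - 1) <= M * K.
  apply/ler_addgt0Pr => e e0.
  have q0 : 0 <= cmod (g z0) / e by rewrite divr_ge0 ?cmod_ge0// ltW.
  have K1 : 1 < cmod (g z0) / e + 1 + 1 by lra.
  have := H _ K1; rewrite addrK => h.
  have qe : cmod (g z0) / e * e = cmod (g z0) by rewrite divfK// gt_eqF.
  rewrite leNgt; apply/negP => lt.
  have : 0 <= (cmod (g z0) - M - e) * (cmod (g z0) / e) by rewrite mulr_ge0//; lra.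
  by move: (cmod (g z0)) (cmod (g z0) / e) q0 h qe lt => G q q0 h qe lt; lra.
move=> K1.
pose A : set (R * R) := [set p | r1 ^+ 2 <= p.1 ^+ 2 + p.2 ^+ 2 <= r2 ^+ 2].
have cmodA (p : R * R) : A p <-> r1 <= cmod (Complex p.1 p.2) <= r2.
  rewrite /A /= -(cmod_sqr (Complex p.1 p.2)).
  have r20 : 0 <= r2 by rewrite (le_trans (ltW r10))// (le_trans r1z).
  by rewrite !ler_sqr ?nnegrE ?cmod_ge0// ltW.
have cA : compact A.
  apply: (@subclosed_compact _ A (`[(- 1 : R), 1] `*` `[(- 1 : R), 1])).
  - have cN : continuous (fun p : R * R => p.1 ^+ 2 + p.2 ^+ 2).
      move=> p; apply: cvgD; rewrite /= expr2.
        by apply: cvgM; exact: cvg_fst.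
      by apply: cvgM; exact: cvg_snd.
    have -> : A = (fun p : R * R => p.1 ^+ 2 + p.2 ^+ 2) @^-1` `[r1 ^+ 2, r2 ^+ 2].
      by apply/seteqP; split => p; rewrite /A /= in_itv.
    by apply: closed_comp; [move=> p _; exact: cN|exact: itv_closed].
  - by apply: compact_setX; exact: (@segment_compact R (- 1) 1).
  - move=> p /cmodA /andP[_ pr2]; rewrite /= !in_itv /= -!ler_norml.
    have := cmod_Re (Complex p.1 p.2); have := cmod_Im (Complex p.1 p.2).
    by rewrite /= => ? ?; split; lra.
have Kpos z : cmod z <= r2 -> 0 < K - cmod z ^+ 2.
  move=> zr; have := cmod_ge0 z => z00; have : cmod z ^+ 2 <= 1.
    by rewrite expr_le1//; lra.
  by lra.
pose psi (p : R * R) := cmod (g (Complex p.1 p.2)) / (K - (p.1 ^+ 2 + p.2 ^+ 2)).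
have inA z : r1 <= cmod z <= r2 -> A (complex.Re z, complex.Im z).
  by move=> zr; apply/cmodA => /=; rewrite complex_ReIm.
have A0 : A !=set0 by exists (complex.Re z0, complex.Im z0); apply: inA; rewrite r1z.
have cpsi : {within A, continuous psi}.
  apply: continuous_in_subspaceT => p; rewrite inE => pA.
  have /andP[pr1 pr2] := (cmodA p).1 pA.
  apply: cvgM.
    apply: (@ccontinuous_pair g); apply: cderivable_continuous; apply: dg.
    by rewrite (lt_le_trans r10)// (le_lt_trans pr2).
  apply: cvgV.
    by rewrite -(cmod_sqr (Complex p.1 p.2)) gt_eqF// Kpos.
  apply: cvgB; first exact: cvg_cst.
  apply: cvgD; rewrite /= expr2.
    by apply: cvgM; exact: cvg_fst.
  by apply: cvgM; exact: cvg_snd.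
have [[x1 y1]] := compact_EVT_max A0 cA cpsi.
rewrite inE => z1A psimax; pose z1 : C := Complex x1 y1.
have /andP[z1r1 z1r2] : r1 <= cmod z1 <= r2 by exact: (cmodA (x1, y1)).1 z1A.
pose ps := psi (x1, y1).
have gps z : r1 <= cmod z <= r2 -> cmod (g z) <= ps * (K - cmod z ^+ 2).
  move=> zr; have /andP[_ zr2'] := zr; rewrite -ler_pdivrMr ?Kpos//.
  have := psimax (complex.Re z, complex.Im z); rewrite inE => /(_ (inA _ zr)).
  by rewrite /psi /= complex_ReIm -cmod_sqr.
have g1 : cmod (g z1) = ps * (K - cmod z1 ^+ 2).
  by rewrite /ps /psi /= -(cmod_sqr z1) divfK// gt_eqF// Kpos.
have ps0 : 0 <= ps.
  have := cmod_ge0 (g z1); rewrite g1 pmulr_lge0//; exact: Kpos.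
suff psM : ps * (K - 1) <= M.
  have z0r : r1 <= cmod z0 <= r2 by rewrite r1z.
  apply: le_trans (ler_wpM2r _ (gps _ z0r)) _; first by lra.
  rewrite mulrAC; apply: ler_pM => //.
  - by rewrite mulr_ge0//; lra.
  - by rewrite ltW// Kpos.
  - by have := sqr_ge0 (cmod z0); lra.
(* Settles a maximum on the boundary: there [ps * (K - cmod z ^+ 2) <= M], and the difference to
   [ps * (K - 1)] is this nonnegative quantity. *)
have bd z : cmod z <= r2 -> 0 <= ps * (1 - cmod z ^+ 2).
  move=> zr; rewrite mulr_ge0//; have := cmod_ge0 z => z00.
  have : cmod z ^+ 2 <= 1 by rewrite expr_le1//; lra.
  by lra.
have [e1|n1] := eqVneq (cmod z1) r1.
  have := gM z1 (or_introl e1); rewrite g1; have := bd z1 z1r2; lra.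
have [e2|n2] := eqVneq (cmod z1) r2.
  have := gM z1 (or_intror e2); rewrite g1; have := bd z1 z1r2; lra.
have [->|psn0] := eqVneq ps 0; first by rewrite mul0r.
have psgt : 0 < ps by rewrite lt_def psn0.
have {}n1 : r1 < cmod z1 by rewrite lt_def n1.
have {}n2 : cmod z1 < r2 by rewrite lt_def eq_sym n2.
exfalso.
pose r := Num.min (cmod z1 - r1) (r2 - cmod z1).
have r0 : 0 < r by rewrite lt_min !subr_gt0 n1.
have rin z : cmod (z - z1) < r -> r1 <= cmod z <= r2.
  rewrite lt_min => /andP[h1 h2].
  have := cmod_sub_le z z1; have := cmod_sub_le z1 z; rewrite (cmodB z1) => ? ?.
  by apply/andP; split; lra.
have gz1 : 0 < cmod (g z1) by rewrite g1 mulr_gt0// Kpos.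
(* The conjugate of [g z1] over its modulus, a rotation that makes [c * g z1] equal to
   [cmod (g z1)]. *)
pose c : C := Complex (complex.Re (g z1) / cmod (g z1)) (- complex.Im (g z1) / cmod (g z1)).
pose G z := c * g z + Complex (2 * ps * x1) (- (2 * ps * y1)) * z.
have c1 : cmod c = 1.
  have -> : c = Complex (cmod (g z1))^-1 0 * Complex (complex.Re (g z1)) (- complex.Im (g z1)).
    by apply/eqP; rewrite eq_complex /=; apply/andP; split; apply/eqP; ring.
  rewrite cmodM cmod_real gtr0_norm ?invr_gt0// /cmod /= sqrrN -/(cmod _) mulVf//.
  by rewrite gt_eqF.
have ReG z : complex.Re (G z) = complex.Re (c * g z) +
    2 * ps * (x1 * complex.Re z + y1 * complex.Im z).
  by rewrite /G cReD; congr (_ + _); rewrite cReM /=; ring.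
have cg1 : complex.Re (c * g z1) = cmod (g z1).
  rewrite cReM /= (_ : _ - _ = (complex.Re (g z1) ^+ 2 + complex.Im (g z1) ^+ 2) / cmod (g z1)).
    by rewrite -cmod_sqr expr2 mulfK// gt_eqF.
  by ring.
have G1 : complex.Re (G z1) = cmod (g z1) + 2 * ps * (cmod z1) ^+ 2.
  by rewrite ReG cg1 (cmod_sqr z1) /z1 /=; ring.
(* The real part of [2 conj(z1) z] is [|z|^2 + |z1|^2 - |z - z1|^2]. On the circle of radius [r / 2]
   the term [|z|^2] cancels against the bound [ps * (K - |z|^2)] and [(r / 2) ^+ 2] is lost, whereas
   at [z1] the value is exactly [ps * (K + |z1|^2)]. *)
suff : complex.Re (G z1) <= ps * (K + cmod z1 ^+ 2 - (r / 2) ^+ 2).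
  rewrite G1 g1 => h; have : 0 < ps * (r / 2) ^+ 2 by rewrite mulr_gt0// exprn_gt0// divr_gt0.
  by lra.
apply: (@Re_circle_max G z1 r (r / 2)).
- move=> z /rin /andP[zr1 zr2']; apply: cderivableD; apply: cderivableM.
  + exact: cderivable_cst.
  + by apply: dg; rewrite (lt_le_trans r10)// (le_lt_trans zr2').
  + exact: cderivable_cst.
  + exact: cderivable_id.
- by apply/andP; split; lra.
- move=> z zr; have /rin zin : cmod (z - z1) < r by rewrite zr; lra.
  rewrite ReG -zr.
  have h1 : complex.Re (c * g z) <= ps * (K - cmod z ^+ 2).
    apply: le_trans (ler_norm _) _; apply: le_trans (cmod_Re _) _.
    by rewrite cmodM c1 mul1r gps.
  apply: le_trans (lerD h1 (lexx _)) _.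
  rewrite !cmod_sqr cReB cImB /= le_eqVlt; apply/orP; left; apply/eqP; ring.
Qed.

End MaximumPrinciple.

(** * Separated monomials *)

Section MonomialComparison.
Variables (R : realFieldType) (a b : R).
Hypotheses (a_ge0 : 0 <= a) (b_ge0 : 0 <= b).

(** The ratio [r ^+ j / r ^+ i] increases with [r]: domination by the lower degree at [y] persists
    to the left of [y], and domination by the higher degree persists to the right. *)
Lemma monomial_le_left (i j : nat) (s y : R) : (i < j)%N -> 0 <= s -> s <= y ->
  b * y ^+ j <= a * y ^+ i -> b * s ^+ j <= a * s ^+ i.
Proof.
move=> ij s0 sy; have y0 := le_trans s0 sy.
rewrite -(subnK (ltnW ij)) !exprD !mulrA.
have [y_0|yn0] := eqVneq y 0.
  have -> : s = 0 by apply/eqP; rewrite eq_le s0 -y_0 sy.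
  by move=> _; rewrite expr0n subn_eq0 leqNgt ij mulr0 mul0r mulr_ge0// exprn_ge0.
have {yn0} yi : 0 < y ^+ i by rewrite exprn_gt0// lt_def yn0.
rewrite ler_pM2r// => h; rewrite ler_wpM2r ?exprn_ge0//; apply: le_trans h.
by rewrite ler_wpM2l// lerXn2r ?nnegrE.
Qed.

Lemma monomial_le_right (i j : nat) (s y : R) : (i <= j)%N -> 0 < y -> y <= s ->
  a * y ^+ i <= b * y ^+ j -> a * s ^+ i <= b * s ^+ j.
Proof.
move=> ij y0 ys; have s0 := lt_le_trans y0 ys.
rewrite -(subnK ij) !exprD !mulrA ler_pM2r ?exprn_gt0// => h.
rewrite ler_pM2r ?exprn_gt0//; apply: le_trans h _.
by rewrite ler_wpM2l// lerXn2r ?nnegrE// ltW.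
Qed.

End MonomialComparison.

Section SeparatedMonomials.
Variables (R : realType) (p : R -> R) (c : R).
Local Notation unit_itv r := (0 <= r < 1).
Hypothesis p_gt0 : forall r, unit_itv r -> 0 < p r.
Hypothesis p_ndecr : forall r s, 0 <= r -> r <= s -> s < 1 -> p r <= p s.
Hypothesis p_unbounded : forall B, exists2 s, unit_itv s &
  forall r, s <= r -> r < 1 -> B <= p r.
Hypothesis c_gt0 : 0 < c.
Hypothesis p_monomial : forall t, 2^-1 <= t -> t < 1 -> exists n a,
  (forall r, unit_itv r -> a * r ^+ n <= p r) /\ c * p t <= a * t ^+ n.

Let half_itv : unit_itv (2^-1 : R).
Proof. by apply/andP; split; lra. Qed.

Let zero_itv : unit_itv (0 : R).
Proof. by rewrite lexx ltr01. Qed.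

Let minorants n := [set a | forall r, unit_itv r -> a * r ^+ n <= p r].
Let M n := sup (minorants n).
Let m n r := M n * r ^+ n.

Let minorants_has_sup n : has_sup (minorants n).
Proof.
split; first by exists 0 => r r01; rewrite mul0r ltW// p_gt0.
exists (p 2^-1 / 2^-1 ^+ n) => a /(_ _ half_itv).
by rewrite ler_pdivlMr// exprn_gt0.
Qed.

Let M_ub n a : minorants n a -> a <= M n.
Proof. by move=> na; apply: sup_ubound => //; exact: (minorants_has_sup n).2. Qed.

Let M_gt0 n : 0 < M n.
Proof.
apply: (lt_le_trans (p_gt0 zero_itv)); apply: M_ub => r r01.
have [r0 r1] := andP r01.
apply: le_trans (_ : p 0 * 1 <= _).
  by rewrite ler_wpM2l ?(ltW (p_gt0 zero_itv))// exprn_ile1// ltW.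
by rewrite mulr1 p_ndecr.
Qed.

Let m_le n r : unit_itv r -> m n r <= p r.
Proof.
move=> r01; have [r0 _] := andP r01.
have /orP[/eqP e|rn] : (0 == r ^+ n) || (0 < r ^+ n) by rewrite -le_eqVlt exprn_ge0.
  by rewrite /m -e mulr0 ltW// p_gt0.
rewrite /m -ler_pdivlMr//; apply: ge_sup; first exact: (minorants_has_sup n).1.
by move=> a /(_ _ r01); rewrite ler_pdivlMr.
Qed.

Let m_ge0 n r : 0 <= r -> 0 <= m n r.
Proof. by move=> r0; rewrite mulr_ge0 ?exprn_ge0// ltW// M_gt0. Qed.

(** If [m n] stayed below [p / 2] everywhere, [2 * M n] would still be a minorant. *)
Let m_touch n : exists2 x, unit_itv x & p x / 2 < m n x.
Proof.
apply: contrapT => /forall2NP no.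
have : 2 * M n <= M n.
  apply: M_ub => r r01; have [//|/negP] := no r; rewrite -leNgt /m; lra.
by have := M_gt0 n; lra.
Qed.

(* If consecutive selected monomials never both exceed [p / 4], each one is at
   most half of its neighbour beyond the point where the neighbour touches [p],
   so the sum is geometric; choosing the next index least leaves no gap. *)
Let sep n n' := forall r, unit_itv r -> m n r <= p r / 4 \/ m n' r <= p r / 4.

(** Any large degree works. Near [1] the growth of [p] beats the bounded [m n]. On [[0, s]] the
    bound [M n' <= p s' / s' ^+ n'], read off at a point [s' > s], makes [m n'] decay like
    [(s / s') ^+ n'], below [p 0 / 4]. *)
Let sep_ex n : exists n', (n < n')%N /\ sep n n'.
Proof.
have [s s01 hs] := p_unbounded (4 * M n); have [s0 s1] := andP s01.
pose s' := (s + 1) / 2.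
have s'01 : unit_itv s' by rewrite /s'; apply/andP; split; lra.
have ss' : 0 <= s / s' < 1.
  by rewrite divr_ge0//= ?ltr_pdivrMr /s'; lra.
have e0 : 0 < p 0 / 4 by rewrite divr_gt0// p_gt0.
have := @cvg_geometric R (p s') (s / s').
rewrite ger0_norm; last by case/andP: ss'.
move=> /(_ (andP ss').2) /cvgrPdist_lt /(_ _ e0)[N _ hN].
exists (maxn N n.+1); split; first by rewrite leq_max ltnSn orbT.
move=> r r01; have [r0 r1] := andP r01; have [sr|rs] := leP s r.
  left; rewrite /m ler_pdivlMr//; apply: le_trans (hs _ sr r1).
  by rewrite mulrC ler_wpM2l// ler_piMr ?(ltW (M_gt0 n))// exprn_ile1// ltW.
right; have := hN _ (leq_maxl N n.+1); set n' := maxn _ _.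
rewrite /= sub0r normrN => /(le_lt_trans (ler_norm _)) h.
have s'0 : 0 < s' by rewrite /s'; lra.
have := m_le n' s'01; rewrite /m => hm.
have sE : s ^+ n' = s' ^+ n' * (s / s') ^+ n'.
  by rewrite -exprMn mulrCA divff ?mulr1// gt_eqF.
apply: le_trans (_ : p s' * (s / s') ^+ n' <= _).
  apply: le_trans (_ : M n' * s ^+ n' <= _).
    by apply: ler_wpM2l; rewrite ?(ltW (M_gt0 _))// lerXn2r ?nnegrE// ltW.
  by rewrite sE mulrA ler_wpM2r// exprn_ge0//; case/andP: ss'.
apply: le_trans (ltW h) _; rewrite ler_wpM2r//; exact: p_ndecr.
Qed.

Let next n : exists n', [/\ (n < n')%N, sep n n' &
  forall i, (n < i)%N -> (i < n')%N -> ~ sep n i].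
Proof.
have ex : exists n', `[< (n < n')%N /\ sep n n' >].
  by have [n' h] := sep_ex n; exists n'; apply/asboolP.
case: (ex_minnP ex) => n' /asboolP[nn' sn'] min; exists n'; split => // i ni iin' si.
have : (n' <= i)%N by apply: min; apply/asboolP.
by rewrite leqNgt iin'.
Qed.

Let M_incr n : M n <= M n.+1.
Proof.
apply: M_ub => r r01; have [r0 r1] := andP r01.
apply: le_trans (m_le n r01); rewrite exprS /m mulrCA.
by rewrite ler_piMl ?m_ge0// ltW.
Qed.

Lemma separated_monomials : exists (a : nat -> R) (n : nat -> nat),
  [/\ forall k, 0 <= a k,
      forall N r, unit_itv r -> \sum_(k < N) a k * r ^+ n k <= 4 * p r &
      exists2 c', 0 < c' & forall t, unit_itv t ->
        exists k, c' * p t <= a k * t ^+ n k].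
Proof.
have [nx hnx] := choice next.
pose n := nat_rect (fun=> nat) 0%N (fun _ i => nx i).
have nS k : (n k < n k.+1)%N by have [] := hnx (n k).
have nsep k : sep (n k) (n k.+1) by have [] := hnx (n k).
have nmin k i : (n k < i)%N -> (i < n k.+1)%N -> ~ sep (n k) i.
  by have [_ _] := hnx (n k); exact.
have nk k : (k <= n k)%N by elim: k => // k /leq_ltn_trans; exact.
have n_gt0 k : (0 < n k.+1)%N by exact: leq_ltn_trans (nS k).
exists (M \o n), n; split => [k /=|N r r01|].
- exact: ltW (M_gt0 _).
- have touch k : exists x, unit_itv x /\ p x / 2 < m (n k) x.
    by have [x] := m_touch (n k); exists x.
  have [x hx] := choice touch.
  have decr k s : 0 <= s -> s <= x k -> m (n k.+1) s <= m (n k) s / 2.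
    have [y01 ym] := hx k; move=> s0 sy.
    have my : m (n k.+1) (x k) <= m (n k) (x k) / 2.
      by have py := p_gt0 y01; case: (nsep k _ y01); lra.
    rewrite /m mulrAC; apply: (monomial_le_left _ _ (nS k) s0 sy).
    + by rewrite divr_ge0// ltW// M_gt0.
    + exact: ltW (M_gt0 _).
    + by rewrite mulrAC.
  have incr k s : x k.+1 <= s -> m (n k) s <= m (n k.+1) s / 2.
    have [y01 ym] := hx k.+1; move=> sy; have [y0 _] := andP y01.
    have my : m (n k) (x k.+1) <= m (n k.+1) (x k.+1) / 2.
      by have py := p_gt0 y01; case: (nsep k _ y01); lra.
    rewrite /m mulrAC; apply: (monomial_le_right _ (ltnW (nS k)) _ sy).
    + by rewrite divr_ge0// ltW// M_gt0.
    + rewrite lt_def y0 andbT; apply/eqP => x0.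
      move: ym; rewrite /m x0 expr0n gtn_eqF// mulr0.
      by have := p_gt0 zero_itv; lra.
    + by rewrite mulrAC.
  (* Otherwise both halvings apply at [x k.+1], and [m (n k.+1)] there would be at most a quarter of
     itself. *)
  have xS k : x k < x k.+1.
    rewrite ltNge; apply/negP => xx; have [y01 ym] := hx k.+1; have [y0 _] := andP y01.
    have := decr k _ y0 xx; have := incr k _ (lexx _).
    by have := p_gt0 y01; lra.
  have [r0 r1] := andP r01; have pr := p_gt0 r01.
  have bp k : m (n k) r <= p r by exact: m_le.
  have b0 k : 0 <= m (n k) r by exact: m_ge0.
  (* Beyond [x K] the terms at least double up to the last, so the sum is at most twice that one.
     Before [x K] the bound keeps a spare copy of the last term, which pays for all later terms
     since each is at most half of its predecessor. *)
  have key K : (x K <= r -> \sum_(k < K.+1) m (n k) r <= 2 * m (n K) r) /\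
      (r < x K -> \sum_(k < K.+1) m (n k) r + m (n K) r <= 4 * p r).
    elim: K => [|K [IH1 IH2]].
      by rewrite big_ord_recr big_ord0 /= add0r; have := bp 0%N; have := b0 0%N; split; lra.
    rewrite big_ord_recr /=; split => h.
      have := IH1 (ltW (lt_le_trans (xS K) h)); have := incr K r h; lra.
    have [xr|rx] := leP (x K) r.
      have := IH1 xr; have := bp K; have := bp K.+1; lra.
    by have := IH2 rx; have := decr K r r0 (ltW rx); lra.
  case: N => [|N]; first by rewrite big_ord0 mulr_ge0// ltW.
  rewrite /= -/(m _ _); have [h1 h2] := key N; have [/h1|/h2] := leP (x N) r.
    by rewrite /m; have := bp N; rewrite /m; lra.
  by have := b0 N; rewrite /m; lra.
- have p0 := p_gt0 zero_itv; have ph := p_gt0 half_itv.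
  (* The first constant serves [t >= 1/2]. The second serves [t < 1/2], where the selected degree
     [n 0 = 0] suffices because [M 0 >= p 0] and [p t <= p 2^-1]. *)
  exists (Num.min (c / 8) (p 0 / p 2^-1)).
    by rewrite lt_min !divr_gt0.
  move=> t t01; have [t0 t1] := andP t01; have pt := p_gt0 t01.
  have [th|th] := ltP t 2^-1.
    exists 0%N; rewrite /= expr0 mulr1.
    apply: le_trans (_ : p 0 / p 2^-1 * p t <= _).
      by rewrite ler_wpM2r ?(ltW pt)// ge_min lexx orbT.
    apply: le_trans (_ : p 0 <= _).
      rewrite mulrAC ler_pdivrMr// ler_wpM2l ?(ltW p0)//.
      by apply: p_ndecr; lra.
    apply: M_ub => r r01; rewrite expr0 mulr1; have [r0 r1] := andP r01.
    exact: p_ndecr.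
  have [i [a [ai ct]]] := p_monomial th t1.
  have {}ct : c * p t <= m i t.
    by apply: le_trans ct _; rewrite ler_wpM2r ?exprn_ge0//; exact: M_ub.
  suff [k hk] : exists k, m i t <= 8 * m (n k) t.
    exists k; apply: le_trans (_ : c / 8 * p t <= _).
      by rewrite ler_wpM2r ?(ltW pt)// ge_min lexx.
    by rewrite /= -/(m _ _); lra.
  have ex : exists k, (i < n k)%N by exists i.+1; exact: leq_trans (nk _).
  case: (ex_minnP ex) => -[|k] // ik kmin.
  have nki : (n k <= i)%N by rewrite leqNgt; apply/negP => /kmin; rewrite ltnn.
  move: nki; rewrite leq_eqVlt => /orP[/eqP <-|nki].
    by exists k; have := m_ge0 (n k) t0; lra.
  (* The degree just below [n k.+1] was rejected by the greedy choice, so at some [y] both [m (n k)]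
     and [m j] exceed [p / 4], hence [m i / 4]. Left of [y] the lower degree [n k] dominates
     [m i / 4], right of [y] the higher degree [j] does. Passing from [j] to [j.+1] costs a factor
     [2] because [t >= 1/2]. *)
  have [j nj] : exists j, n k.+1 = j.+1 by exists (n k.+1).-1; rewrite prednK.
  have ij : (i <= j)%N by rewrite -ltnS -nj.
  have nkj : (n k < j)%N by exact: leq_trans ij.
  have : ~ sep (n k) j by apply: nmin => //; rewrite nj.
  move=> /existsNP[y /not_implyP[y01 /not_orP[/negP y1 /negP y2]]].
  rewrite -!ltNge in y1 y2; have [y0 _] := andP y01.
  have py := p_gt0 y01; have miy := m_le i y01.
  have [ty|yt] := leP t y.
    exists k; apply: le_trans (_ : 4 * M (n k) * t ^+ n k <= _).
      apply: (monomial_le_left _ _ nki t0 ty).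
      + by rewrite mulr_ge0// ltW// M_gt0.
      + exact: ltW (M_gt0 _).
      + by move: miy y1; rewrite /m; lra.
    by have := m_ge0 (n k) t0; rewrite /m; lra.
  exists k.+1; rewrite nj.
  have h : m i t <= 4 * M j * t ^+ j.
    apply: (monomial_le_right _ ij _ (ltW yt)).
    + by rewrite mulr_ge0// ltW// M_gt0.
    + rewrite lt_def y0 andbT; apply/eqP => y_0.
      move: y2; rewrite /m y_0 expr0n gtn_eqF ?mulr0; last exact: leq_ltn_trans nkj.
      by lra.
    + by move: miy y2; rewrite /m; lra.
  apply: le_trans h _.
  have : M j * t ^+ j <= M j.+1 * t ^+ j by rewrite ler_wpM2r ?exprn_ge0 ?M_incr.
  have : 2^-1 * (M j.+1 * t ^+ j) <= t * (M j.+1 * t ^+ j).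
    by rewrite ler_wpM2r// mulr_ge0 ?exprn_ge0// ltW// M_gt0.
  rewrite /m exprS (mulrCA (M j.+1)); lra.
Qed.

End SeparatedMonomials.

(** * Limits along an ultrafilter *)

Section UltraLimits.
Variable R : realType.
Local Notation C := R[i].

(** Every bounded sequence converges along the same ultrafilter, so limits at all points of the
    disc, or of all moments, coexist without a diagonal extraction. *)
Lemma nat_ultrafilter : exists2 U : set_system nat, UltraFilter U & \oo `<=` U.
Proof. by have [U [UU sU]] := @ultraFilterLemma nat \oo _; exists U. Qed.

Variable U : set_system nat.
Hypothesis ultraU : UltraFilter U.

Lemma ulim_real (u : nat -> R) (K : R) : (forall n, `|u n| <= K) ->
  exists l, forall e, 0 < e -> U [set n | `|u n - l| < e].
Proof.
move=> uK; have := @segment_compact R (- K) K => /(_ (u @ U) _).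
case=> [|l [_ cl]].
  have sub : setT `<=` u @^-1` (`[- K, K]).
    by move=> n _; rewrite /= in_itv /= -ler_norml; exact: uK.
  exact: (@filterS nat U _ _ _ sub filterT).
exists l => e e0.
have [//|UC] := @in_ultra_setVsetC _ U [set n | `|u n - l| < e] _.
have [] := cl [set y | ~ `|y - l| < e] (ball l e).
- exact: UC.
- exact: nbhsx_ballx.
- by move=> y [/= ny]; rewrite /ball /= distrC.
Qed.

Definition ulim_to (u : nat -> C) (l : C) :=
  forall e : R, 0 < e -> U [set n | cmod (u n - l) < e].

Lemma ulim_bounded (u : nat -> C) (K : R) : (forall n, cmod (u n) <= K) ->
  exists l, ulim_to u l.
Proof.
move=> uK.
have [a ha] := @ulim_real (fun n => complex.Re (u n)) K
  (fun n => le_trans (cmod_Re (u n)) (uK n)).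
have [b hb] := @ulim_real (fun n => complex.Im (u n)) K
  (fun n => le_trans (cmod_Im (u n)) (uK n)).
exists (Complex a b) => e e0; have e2 : 0 < e / 2 by rewrite divr_gt0.
apply: filterS (filterI (ha _ e2) (hb _ e2)) => n /= [h1 h2].
apply: le_lt_trans (cmod_le_ReIm _) _; rewrite cReB cImB /=; lra.
Qed.

Lemma ulimB u u' l l' : ulim_to u l -> ulim_to u' l' ->
  ulim_to (fun n => u n - u' n) (l - l').
Proof.
move=> h h' e e0; have e2 : 0 < e / 2 by rewrite divr_gt0.
apply: filterS (filterI (h _ e2) (h' _ e2)) => n /= [h1 h2].
rewrite (_ : _ - _ = (u n - l) - (u' n - l')); last by ring.
by apply: le_lt_trans (cmodBD _ _) _; lra.
Qed.

Lemma ulimMl u l (c : C) : ulim_to u l -> ulim_to (fun n => u n * c) (l * c).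
Proof.
move=> h e e0.
have c0 : 0 < cmod c + 1 by rewrite ltr_wpDl// cmod_ge0.
apply: filterS (h _ (divr_gt0 e0 c0)) => n /=.
rewrite ltr_pdivlMr// -mulrBl cmodM; apply: le_lt_trans.
by rewrite ler_wpM2l ?cmod_ge0// lerDl.
Qed.

Lemma ulim_le u l (w : C) (B : R) : ulim_to u l ->
  U [set n | cmod (u n - w) <= B] -> cmod (l - w) <= B.
Proof.
move=> h hB; apply/ler_addgt0Pr => e e0.
have UI : U ([set n | cmod (u n - l) < e] `&` [set n | cmod (u n - w) <= B]).
  by apply: filterI => //; exact: h.
have [n /= [h1 h2]] := filter_ex UI.
by have := cmod_tri l (u n) w; rewrite (cmodB l (u n)); lra.
Qed.

(** Plays the part of Weierstrass's convergence theorem. The bounded derivatives [D n] have a limit,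
    and the error bound, being uniform in [n], passes to the limit with them. *)
Lemma holomorphic_ulim (F : nat -> C -> C) :
  (forall z, disc z -> exists K : R, forall n, cmod (F n z) <= K) ->
  (forall z, disc z -> exists (d B K : R) (D : nat -> C),
    [/\ 0 < d, forall n, cmod (D n) <= K &
      forall n h, 0 < cmod h < d -> disc (z + h) /\
        cmod ((F n (z + h) - F n z) / h - D n) <= B * cmod h]) ->
  exists2 g, holomorphic_disc g & forall z, disc z -> ulim_to (F ^~ z) (g z).
Proof.
move=> Fb Fd.
have : forall z, exists w, disc z -> ulim_to (F ^~ z) w.
  move=> z; have [/Fb[K /ulim_bounded[w hw]]|nz] := pselect (disc z).
    by exists w.
  by exists 0.
move=> /choice[g hg]; exists g => // z zD.
have [d [B [K [D [d0 /ulim_bounded[L hL] hD]]]]] := Fd z zD.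
exists L => e e0; exists (Num.min d (e / (`|B| + 1))).
  by rewrite lt_min d0 divr_gt0// ltr_wpDl.
move=> h; rewrite lt_min => /and3P[h0 hd he].
have zhD : disc (z + h) by have [] := hD 0%N h; rewrite ?h0 ?hd.
have lim : ulim_to (fun n => (F n (z + h) - F n z) / h - D n) ((g (z + h) - g z) / h - L).
  by apply: ulimB => //; apply: ulimMl; apply: ulimB; exact: hg.
have : cmod ((g (z + h) - g z) / h - L - 0) <= B * cmod h.
  apply: ulim_le lim _; apply: filterS filterT => n _ /=.
  by rewrite subr0; have [] := hD n h; rewrite ?h0 ?hd.
rewrite subr0 => /le_lt_trans; apply.
move: he; rewrite ltr_pdivlMr ?ltr_wpDl//; apply: le_lt_trans.
rewrite mulrC ler_wpM2l ?(ltW h0)//.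
by apply: le_trans (ler_norm _) _; rewrite lerDl.
Qed.

End UltraLimits.

(** * A function of maximal growth *)

Section WeightedSpaces.
Variable R : realType.
Local Notation C := R[i].
Implicit Types (v w : R -> R) (f g : C -> C).

Lemma near_left1P (P : R -> Prop) : (\forall x \near (1 : R)^'-, P x) <->
  exists2 s, 0 <= s < 1 & forall x, s < x -> x < 1 -> P x.
Proof.
split=> [/nbhs_ballP[d /= d0 hd]|[s /andP[_ s1] hs]]; last first.
  by near=> x; apply: hs; near: x; [exact: nbhs_left_gt|exact: nbhs_left_lt].
exists (Num.max 0 (1 - d)); first by rewrite le_max lexx/= gt_max ltr01 /=; lra.
move=> x; rewrite gt_max => /andP[_ xd] x1; apply: hd => //.
by rewrite /ball /= gtr0_norm; lra.
Unshelve. all: by end_near. Qed.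

Lemma weight_gt0 v z : weight v -> disc z -> 0 < v (cmod z).
Proof. by case=> v0 _ _ _ zD; apply: v0; rewrite cmod_ge0. Qed.

Lemma weight_small v e : weight v -> 0 < e ->
  exists2 s, 0 <= s < 1 & forall x, s < x -> x < 1 -> v x < e.
Proof.
case=> v0 _ _ /cvgrPdist_lt cv e0; apply/near_left1P.
near=> x; apply: le_lt_trans (ler_norm _) _.
rewrite -normrN -sub0r; near: x; exact: cv.
Unshelve. all: by end_near. Qed.

Lemma disc0 : disc (0 : C). Proof. by rewrite /disc /= cmod0. Qed.

Lemma disc_real (t : R) : 0 <= t < 1 -> disc (Complex t 0).
Proof. by move=> /andP[t0 t1]; rewrite /disc /= cmod_real ger0_norm. Qed.

(** The premise is a real one: [sup] of an unbounded set is [0], so [wnorm] controls [f] only once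
    boundedness is known. *)
Lemma wnorm_ub v f z : (exists M, forall z, disc z -> v (cmod z) * cmod (f z) <= M) ->
  disc z -> v (cmod z) * cmod (f z) <= wnorm v f.
Proof.
move=> [M fM] zD; apply: sup_ubound; last by exists z.
by exists M => _ [y yD <-]; exact: fM.
Qed.

Lemma wnorm_le v f B : (forall z, disc z -> v (cmod z) * cmod (f z) <= B) ->
  wnorm v f <= B.
Proof.
move=> fB; apply: ge_sup; last by move=> _ [z zD <-]; exact: fB.
by exists (v (cmod (0 : C)) * cmod (f 0)); exists 0 => //; exact: disc0.
Qed.

Lemma wnorm_ge0 v f : weight v -> 0 <= wnorm v f.
Proof.
move=> wv; have [hs|/sup_out e] := pselect (has_sup [set v (cmod z) * cmod (f z) | z in @disc R]);
  last by rewrite /wnorm e.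
apply: le_trans (_ : v (cmod (0 : C)) * cmod (f 0) <= _).
  by rewrite mulr_ge0 ?cmod_ge0// ltW// weight_gt0//; exact: disc0.
by apply: sup_ubound; [exact: hs.2|exists 0 => //; exact: disc0].
Qed.

(** The supremum in [essential] need not be attained; settling for a function above half of it gives
    the constant [c / 2]. A positive value of [sup] also certifies that the set is bounded. *)
Lemma essential_extremal v : weight v -> essential v ->
  exists2 c, 0 < c & forall z0, disc z0 -> exists f,
    [/\ holomorphic_disc f, forall z, disc z -> cmod (f z) <= (v (cmod z))^-1 &
        c * (v (cmod z0))^-1 < cmod (f z0)].
Proof.
move=> wv [c c0 ess]; exists (c / 2); first by rewrite divr_gt0.
move=> z0 z0D; have /andP[lo _] := ess _ z0D.
set S := [set _ | _ in _] in lo.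
have vz := weight_gt0 wv z0D.
have supS : 0 < sup S by apply: lt_le_trans lo; rewrite divr_gt0.
have hS : has_sup S.
  by apply: contrapT => /sup_out e; rewrite e ltxx in supS.
have e0 : 0 < sup S / 2 by rewrite divr_gt0.
have [_ [f [Hf nf] <-] hf] := sup_adherent e0 hS.
exists f; split; [by case: Hf| |by move: lo hf; lra].
move=> z zD; have vz' := weight_gt0 wv zD.
rewrite -[leRHS]mul1r ler_pdivlMr// mulrC; apply: le_trans nf.
by apply: wnorm_ub => //; case: Hf.
Qed.

(* The maximum principle for [f / z^n] on an annulus around [t]: the tangent
   monomial of degree [n] at [t] stays below [1/v] on one of the two sides. *)
Lemma monomial_dichotomy v c n t : weight v ->
  (forall z0, disc z0 -> exists f,
    [/\ holomorphic_disc f, forall z, disc z -> cmod (f z) <= (v (cmod z))^-1 &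
        c * (v (cmod z0))^-1 < cmod (f z0)]) ->
  0 < t -> t < 1 ->
  (forall r, t < r -> r < 1 -> c * (v t)^-1 * r ^+ n <= t ^+ n * (v r)^-1) \/
  (forall r, 0 < r -> r < t -> c * (v t)^-1 * r ^+ n <= t ^+ n * (v r)^-1).
Proof.
move=> wv ext t0 t1; apply: contrapT => /not_orP[/existsNP[r2 no2] /existsNP[r1 no1]].
have [tr2 [r21 /negP h2]] : t < r2 /\ r2 < 1 /\ ~ (c * (v t)^-1 * r2 ^+ n <= t ^+ n * (v r2)^-1).
  by move: no2 => /not_implyP[? /not_implyP[]].
have [r10 [r1t /negP h1]] : 0 < r1 /\ r1 < t /\ ~ (c * (v t)^-1 * r1 ^+ n <= t ^+ n * (v r1)^-1).
  by move: no1 => /not_implyP[? /not_implyP[]].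
rewrite -!ltNge in h1 h2.
pose z0 : C := Complex t 0.
have z0t : cmod z0 = t by rewrite cmod_real gtr0_norm.
have z0D : disc z0 by rewrite /disc /= z0t.
have [f [hf fv]] := ext _ z0D; rewrite z0t => fz0.
have tn : 0 < t ^+ n by rewrite exprn_gt0.
pose g z := f z * (z ^+ n)^-1.
have : cmod (g z0) <= c * (v t)^-1 / t ^+ n.
  apply: (@annulus_max _ g r1 r2) => //; rewrite ?z0t ?ltW//.
    move=> z /andP[z_0 z_1]; apply: cderivableM; first exact: hf.
    apply: (@cderivableV _ (fun x => x ^+ n)); last exact: cderivableX.
    by rewrite -cmod_gt0 cmodX exprn_gt0.
  have bd r : 0 < r -> r < 1 -> t ^+ n * (v r)^-1 < c * (v t)^-1 * r ^+ n ->
      forall z, cmod z = r -> cmod (g z) <= c * (v t)^-1 / t ^+ n.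
    move=> r0 rl1 hr z zr; rewrite /g cmodM cmodV cmodX zr ler_pdivrMr ?exprn_gt0//.
    rewrite mulrAC ler_pdivlMr//; apply: le_trans (ltW hr).
    rewrite mulrC ler_wpM2l ?(ltW tn)// -zr; apply: fv; rewrite /disc /= zr//.
  move=> z [zr|zr]; [apply: (bd r1)|apply: (bd r2)] => //.
    exact: lt_trans t1.
  exact: lt_trans tr2.
rewrite /g cmodM cmodV cmodX z0t ler_pM2r ?invr_gt0//.
by rewrite leNgt fz0.
Qed.

(** The degree [n] is the last one before the right-hand alternative of [monomial_dichotomy] first
    fails. The left-hand alternative then holds for [n.+1], and it bounds the monomial of degree [n]
    up to the factor [t / r], at most [2] for [r >= t / 2]. *)
Lemma essential_monomials v : weight v -> essential v ->
  exists2 c, 0 < c & forall t, 2^-1 <= t -> t < 1 -> exists n a,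
    (forall r, 0 <= r < 1 -> a * r ^+ n <= (v r)^-1) /\ c * (v t)^-1 <= a * t ^+ n.
Proof.
move=> wv ess; have [c c0 ext] := essential_extremal wv ess.
have [v0 _ vmono _] := wv.
pose p r := (v r)^-1.
have p0 r : 0 <= r < 1 -> 0 < p r by move=> r01; rewrite invr_gt0 v0.
have pmono r s : 0 <= r -> r <= s -> s < 1 -> p r <= p s.
  move=> r0 rs s1; rewrite lef_pV2 ?posrE ?v0 ?r0 ?(le_lt_trans rs)//; last first.
    by rewrite (le_trans r0).
  exact: vmono.
have half : 0 <= (2^-1 : R) < 1 by apply/andP; split; lra.
have zero : 0 <= (0 : R) < 1 by rewrite lexx ltr01.
(* Serves both ranges to the left of [t]: it turns the constant [2 * p 2^-1] into [p 0], and
   [2 * k <= 1] absorbs the factor [t / r <= 2]. *)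
pose k := p 0 / (2 * p 2^-1).
have k0 : 0 < k by rewrite divr_gt0 ?mulr_gt0 ?p0.
have k2 : 2 * k <= 1.
  rewrite (_ : 2 * k = p 0 / p 2^-1); last by rewrite /k; field; rewrite gt_eqF ?p0.
  by rewrite ler_pdivrMr ?p0// mul1r pmono//; lra.
exists (k * c); first by rewrite mulr_gt0.
move=> t th t1; have t0 : 0 < t by lra.
have t01 : 0 <= t < 1 by rewrite ltW.
have pt := p0 _ t01.
have cp1 : c <= 1.
  have [f [_ fv]] := ext _ (disc_real t01); rewrite cmod_real gtr0_norm// => h1.
  have := fv _ (disc_real t01); rewrite cmod_real gtr0_norm// => /(lt_le_trans h1).
  by rewrite -[X in _ < X]mul1r ltr_pM2r// => /ltW.
pose A n := forall r, t < r -> r < 1 -> c * p t * r ^+ n <= t ^+ n * p r.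
(* If [A n] held for all [n], evaluating at the midpoint [r] of [t] and [1] would give
   [c * p t <= p r * (t / r) ^+ n], which tends to [0]. *)
have exN : exists n, `[< ~ A n >].
  apply: contrapT => /forallNP allA.
  have {}allA n : A n by apply: contrapT => nA; exact: (allA n (asboolT nA)).
  pose r := (t + 1) / 2.
  have tr : t < r by rewrite /r; lra.
  have r1 : r < 1 by rewrite /r; lra.
  have r0 : 0 < r := lt_trans t0 tr.
  have q0 : 0 <= t / r by apply: divr_ge0; exact: ltW.
  have q01 : `|t / r| < 1 by rewrite ger0_norm// (ltr_pdivrMr _ _ r0) mul1r.
  have cp0 : 0 < c * p t by rewrite mulr_gt0.
  have := cvg_geometric (p r) q01; move=> /cvgrPdist_lt /(_ _ cp0)[N _ /(_ N (leqnn N))] /=.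
  rewrite sub0r normrN => /(le_lt_trans (ler_norm _)).
  rewrite exprMn exprVn mulrA ltr_pdivrMr ?exprn_gt0// mulrC.
  by rewrite ltNge (allA N).
(* The least failing degree is a successor: [A 0] holds because [c <= 1] and [p] is monotone. *)
case: (ex_minnP exN) => -[|n] /asboolP nA minA.
  exfalso; apply: nA => r tr r1; rewrite !expr0 mulr1 mul1r.
  apply: le_trans (_ : 1 * p t <= _); first by rewrite ler_wpM2r// ltW.
  by rewrite mul1r pmono// ltW.
have An : A n.
  by apply: contrapT => /asboolP /minA; rewrite ltnn.
have [//|B] := monomial_dichotomy n.+1 wv ext t0 t1.
have tn : 0 < t ^+ n by rewrite exprn_gt0.
exists n, (k * (c * p t) / t ^+ n); split; last first.
  by rewrite divfK ?gt_eqF// mulrA.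
move=> r r01; have [r0 r1] := andP r01; have pr := p0 _ r01.
rewrite mulrAC ler_pdivrMr// -mulrA -/(p r).
have p0r : p 0 <= p r by exact: pmono.
have cpt : 0 < c * p t by rewrite mulr_gt0.
(* For small [r] the factor [t / r] is unbounded. There [B] is used at [t / 2] instead and bounds
   [c * p t / 2 ^+ n] by a constant independent of [t] and [n]. *)
have [rt|tr] := ltP r (t / 2).
  have Bh : c * p t * 2^-1 ^+ n <= 2 * p 2^-1.
    have th0 : 0 < t / 2 by rewrite divr_gt0.
    have tt : t / 2 < t by lra.
    have := B _ th0 tt; rewrite -/(p t) -/(p (t / 2)) exprMn mulrCA ler_pM2l ?exprn_gt0//.
    have pth : p (t / 2) <= p 2^-1 by apply: pmono; lra.
    by rewrite exprS mulrCA; lra.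
  have rn : r ^+ n <= t ^+ n * 2^-1 ^+ n.
    by rewrite -exprMn lerXn2r ?nnegrE ?divr_ge0 ?(ltW t0) ?(ltW rt).
  have h1 : c * p t * r ^+ n <= t ^+ n * (2 * p 2^-1).
    apply: le_trans (ler_wpM2l (ltW cpt) rn) _.
    by rewrite mulrCA ler_wpM2l ?(ltW tn).
  apply: le_trans (ler_wpM2l (ltW k0) h1) _.
  rewrite (_ : k * _ = p 0 * t ^+ n); last by rewrite /k; field; rewrite gt_eqF ?p0.
  by rewrite ler_wpM2r ?(ltW tn).
suff h : c * p t * r ^+ n <= 2 * (p r * t ^+ n).
  apply: le_trans (ler_wpM2l (ltW k0) h) _.
  rewrite (_ : k * _ = 2 * k * (p r * t ^+ n)); last by ring.
  by rewrite ler_piMl// mulr_ge0// ltW.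
rewrite (mulrC (p r)).
have [rt|] := ltP r t.
  have r0' : 0 < r by lra.
  have := B r r0' rt; rewrite -/(p t) -/(p r) !exprS => h.
  have h' : r * (c * p t * r ^+ n) <= t * (t ^+ n * p r).
    by rewrite (_ : r * _ = c * p t * (r * r ^+ n)) 1?[leRHS]mulrA//; ring.
  rewrite -(ler_pM2l r0'); apply: le_trans h' _.
  rewrite (_ : r * _ = 2 * r * (t ^+ n * p r)); last by ring.
  by rewrite ler_wpM2r ?mulr_ge0 ?(ltW tn) ?(ltW pr)//; lra.
rewrite le_eqVlt => /predU1P[<-|tr'].
  rewrite (_ : c * p t * t ^+ n = c * (t ^+ n * p t)); last by ring.
  by rewrite ler_wpM2r ?mulr_ge0 ?(ltW tn) ?(ltW pt)//; lra.
apply: le_trans (An r tr' r1) _; rewrite ler_peMl ?ler1n// mulr_ge0// ltW//.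
Qed.

(** * Sums of monomials with nonnegative coefficients *)

Lemma natr_exprS (K : comNzRingType) n (z : K) :
  n.+1%:R * z ^+ n = z * (n%:R * z ^+ n.-1) + z ^+ n.
Proof.
case: n => [|n] /=; first by rewrite mul1r mul0r mulr0 add0r.
by rewrite mulrCA -exprS -natr1 mulrDl mul1r.
Qed.

(** The remainder is [h ^+ 2] times a polynomial in [z] and [h] with nonnegative coefficients.
    Replacing [z] and [h] by the real numbers [cmod z] and [d] enlarges that polynomial, and the
    ratio of the squares comes out in front. *)
Lemma expr_second_order (z h : C) (d : R) n : 0 < d -> cmod h <= d ->
  cmod ((z + h) ^+ n - z ^+ n - n%:R * z ^+ n.-1 * h) <=
  (cmod h / d) ^+ 2 * ((cmod z + d) ^+ n - cmod z ^+ n - n%:R * cmod z ^+ n.-1 * d).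
Proof.
move=> d0 hd; have x0 := cmod_ge0 z; have h0 := cmod_ge0 h.
elim: n => [|n IH].
  by rewrite !expr0 !mul0r !subr0 !subrr cmod0 mulr0.
have -> : (z + h) ^+ n.+1 - z ^+ n.+1 - n.+1%:R * z ^+ n.+1.-1 * h =
  (z + h) * ((z + h) ^+ n - z ^+ n - n%:R * z ^+ n.-1 * h) + n%:R * z ^+ n.-1 * h ^+ 2.
  by rewrite natr_exprS !exprS; ring.
have -> : (cmod z + d) ^+ n.+1 - cmod z ^+ n.+1 - n.+1%:R * cmod z ^+ n.+1.-1 * d =
  (cmod z + d) * ((cmod z + d) ^+ n - cmod z ^+ n - n%:R * cmod z ^+ n.-1 * d)
   + n%:R * cmod z ^+ n.-1 * d ^+ 2.
  by rewrite natr_exprS !exprS; ring.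
apply: le_trans (cmodD _ _) _; rewrite [leRHS]mulrDr lerD//.
  rewrite cmodM mulrCA; apply: ler_pM => //; rewrite ?cmod_ge0//.
  by apply: le_trans (cmodD _ _) _; rewrite lerD2l.
rewrite !cmodM !cmodX.
have -> : (n%:R : C) = Complex n%:R 0 by rewrite -[RHS]/(n%:R%:C)%C rmorph_nat.
rewrite cmod_real ger0_norm ?ler0n//.
by rewrite [leRHS](_ : _ = n%:R * cmod z ^+ n.-1 * cmod h ^+ 2)//; field; rewrite gt_eqF.
Qed.

Lemma natr_expr_le (x d : R) n : 0 <= x -> 0 <= d ->
  n%:R * x ^+ n.-1 * d <= (x + d) ^+ n.
Proof.
move=> x0 d0; elim: n => [|n IH]; first by rewrite !mul0r expr0.
rewrite natr_exprS mulrDl -mulrA exprS mulrDl lerD//.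
  by rewrite ler_wpM2l.
rewrite mulrC ler_wpM2l//; apply: lerXn2r; rewrite ?nnegrE ?addr_ge0//.
by rewrite lerDl.
Qed.

(** [f] is the ultrafilter limit of the partial sums [F N] of separated monomials. Nonnegative
    coefficients reduce each estimate to [sum_le] at a real radius: [cmod z] for the size,
    [cmod z + d] for derivatives and difference quotients. *)
Lemma dominating_function v : weight v -> essential v ->
  exists f c, [/\ Hinf v f, 0 < c & forall t, 0 <= t < 1 ->
    complex.Im (f (Complex t 0)) = 0 /\ c * (v t)^-1 <= complex.Re (f (Complex t 0))].
Proof.
move=> wv ess; have [c c0 mono] := essential_monomials wv ess.
have [v0 _ vmono _] := wv.
have p0 r : 0 <= r < 1 -> 0 < (v r)^-1 by move=> r01; rewrite invr_gt0 v0.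
have pmono r s : 0 <= r -> r <= s -> s < 1 -> (v r)^-1 <= (v s)^-1.
  move=> r0 rs s1; rewrite lef_pV2 ?posrE ?v0 ?r0 ?(le_lt_trans rs)//; last first.
    by rewrite (le_trans r0).
  exact: vmono.
have punb B : exists2 s, 0 <= s < 1 & forall r, s <= r -> r < 1 -> B <= (v r)^-1.
  have B0 : 0 < `|B| + 1 by rewrite ltr_wpDl.
  have B1 : 0 < (`|B| + 1)^-1 by rewrite invr_gt0.
  have [s /andP[s0 s1] hs] := weight_small wv B1.
  exists ((s + 1) / 2); first by apply/andP; split; lra.
  move=> r sr r1; have vr : 0 < v r by apply: v0; apply/andP; split; lra.
  apply: le_trans (ler_norm _) _; apply: le_trans (_ : `|B| + 1 <= _); first by lra.
  rewrite -[leLHS]invrK lef_pV2 ?posrE ?invr_gt0// ltW// hs//; lra.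
have [a [n [a0 sum_le [c' c'0 cover]]]] :=
  @separated_monomials R (fun r => (v r)^-1) c p0 pmono punb c0 mono.
pose F N z : C := \sum_(k < N) Complex (a k) 0 * z ^+ n k.
have Fle N z : disc z -> cmod (F N z) <= 4 * (v (cmod z))^-1.
  move=> zD; apply: le_trans (sum_le N _ _); last by rewrite cmod_ge0.
  rewrite /F; elim/big_ind2 : _ => [|x1 x2 y1 y2 h1 h2|k _].
  - by rewrite cmod0.
  - by apply: le_trans (cmodD _ _) _; exact: lerD.
  - by rewrite cmodM cmodX cmod_real ger0_norm.
have [U UU ooU] := nat_ultrafilter.
have [f hf fU] : exists2 f, holomorphic_disc f & forall z, disc z -> ulim_to U (F ^~ z) (f z).
  apply: holomorphic_ulim => z zD.
    by exists (4 * (v (cmod z))^-1) => N; exact: Fle.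
  have zD' : cmod z < 1 by exact: zD.
  have x0 := cmod_ge0 z.
  pose d := (1 - cmod z) / 2; have d0 : 0 < d by rewrite divr_gt0// subr_gt0.
  have xd1 : 0 <= cmod z + d < 1 by rewrite /d; apply/andP; split; lra.
  pose B := 4 * (v (cmod z + d))^-1.
  exists d, (B / d ^+ 2), (B / d),
    (fun N => \sum_(k < N) Complex (a k) 0 * ((n k)%:R * z ^+ (n k).-1)).
  split=> // [N|N h /andP[h0 hd]].
    rewrite ler_pdivlMr//; apply: le_trans (sum_le N _ xd1).
    rewrite mulrC -[X in X * _](gtr0_norm d0) -cmod_real -cmodM mulr_sumr.
    elim/big_ind2 : _ => [|x1 x2 y1 y2 h1 h2|k _].
    - by rewrite cmod0.
    - by apply: le_trans (cmodD _ _) _; exact: lerD.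
    - have -> : ((n k)%:R : C) = Complex (n k)%:R 0 by rewrite -[RHS]/((n k)%:R%:C)%C rmorph_nat.
      rewrite !cmodM cmodX !cmod_real (gtr0_norm d0) !ger0_norm ?ler0n//.
      rewrite mulrCA ler_wpM2l// mulrC; apply: natr_expr_le => //; exact: ltW.
  split.
    rewrite /disc /=; apply: le_lt_trans (cmodD _ _) _; have /andP[_ ?] := xd1; lra.
  rewrite -[h in _ / h - _]divr1 -(mulfK (_ : h != 0) (\sum_(k < N) _)); last by rewrite -cmod_gt0.
  rewrite divr1 -mulrBl cmodM cmodV ler_pdivrMr//.
  rewrite -mulrA -expr2 mulrAC -mulrA -expr_div_n.
  rewrite /F mulr_suml -!sumrB mulrC.
  apply: le_trans (_ : (cmod h / d) ^+ 2 * \sum_(k < N) a k * (cmod z + d) ^+ n k <= _).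
    rewrite mulr_sumr; elim/big_ind2 : _ => [|x1 x2 y1 y2 h1 h2|k _].
    - by rewrite cmod0.
    - by apply: le_trans (cmodD _ _) _; exact: lerD.
    - rewrite (_ : _ - _ = Complex (a k) 0 *
        ((z + h) ^+ n k - z ^+ n k - (n k)%:R * z ^+ (n k).-1 * h)); last by ring.
      rewrite cmodM cmod_real ger0_norm// mulrCA ler_wpM2l//.
      apply: le_trans (expr_second_order z (n k) d0 (ltW hd)) _.
      rewrite ler_wpM2l ?sqr_ge0// -addrA -opprD gerBl addr_ge0 ?exprn_ge0//.
      by rewrite mulr_ge0 ?(ltW d0)// mulr_ge0 ?ler0n ?exprn_ge0.
  by rewrite ler_wpM2l ?sqr_ge0//; exact: sum_le.
have fle z : disc z -> cmod (f z) <= 4 * (v (cmod z))^-1.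
  move=> zD; rewrite -(subr0 (f z)); apply: (ulim_le UU (fU z zD)).
  by apply: (@filterS nat U _ _ _ _ filterT) => N _ /=; rewrite subr0; exact: Fle.
exists f, c'; split => //.
  split => //; exists 4 => z zD; have vz := weight_gt0 wv zD.
  apply: le_trans (ler_wpM2l (ltW vz) (fle z zD)) _.
  by rewrite mulrCA divff ?mulr1// gt_eqF.
move=> t t01; have [t0 t1] := andP t01; have tD := disc_real t01.
have FE N : F N (Complex t 0) = Complex (\sum_(k < N) a k * t ^+ n k) 0.
  rewrite -[RHS]/((\sum_(k < N) a k * t ^+ n k)%:C)%C rmorph_sum.
  by apply: eq_bigr => k _; rewrite rmorphM rmorphXn.
have [k hk] := cover t t01.
(* All indices beyond [k] form a set of [U], so the approximating partial sum may be taken to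
   contain the term [k] that exceeds [c' * (v t)^-1]. *)
have near e : 0 < e -> exists2 N, (k < N)%N & cmod (F N (Complex t 0) - f (Complex t 0)) < e.
  move=> e0.
  have UI : U ([set N | cmod (F N (Complex t 0) - f (Complex t 0)) < e] `&` [set N | (k < N)%N]).
    by apply: filterI; [exact: fU|apply: ooU; exists k.+1].
  by have [N [/= h1 h2]] := filter_ex UI; exists N.
split.
  apply/eqP; rewrite -normr_le0; apply/ler_addgt0Pr => e e0; rewrite add0r.
  have [N _ h] := near e e0; apply: le_trans (ltW h); apply: le_trans _ (cmod_Im _).
  by rewrite cImB FE /= sub0r normrN.
apply/ler_addgt0Pr => e e0; have [N kN h] := near e e0.
have := le_lt_trans (cmod_Re _) h; rewrite cReB FE /= ltr_norml => /andP[_ h'].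
have : a k * t ^+ n k <= \sum_(k < N) a k * t ^+ n k.
  rewrite (bigD1 (Ordinal kN)) //= lerDl sumr_ge0// => i _.
  by rewrite mulr_ge0 ?exprn_ge0.
lra.
Qed.

End WeightedSpaces.

(** * The integral operator *)

Section CauchyTransform.
Variables (R : realType) (mu : {measure set R -> \bar R}) (v : R -> R).
Local Notation C := R[i].
Local Notation D := (`[0, 1[ : set R).
Implicit Types (f g q : C -> C) (z : C).

Lemma cintegrable_dominated (g : R -> C) (B : R -> R) :
  measurable_fun D (fun t => complex.Re (g t)) ->
  measurable_fun D (fun t => complex.Im (g t)) ->
  mu.-integrable D (EFin \o B) -> (forall t, D t -> cmod (g t) <= B t) ->
  cintegrable mu D g.
Proof.
move=> mRe mIm iB gB; split; apply: (le_integrable _ _ _ iB) => //.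
- exact/measurable_EFinP.
- move=> t tD; rewrite /= lee_fin; apply: le_trans (cmod_Re _) _.
  by apply: le_trans (gB t tD) _; exact: ler_norm.
- exact/measurable_EFinP.
- move=> t tD; rewrite /= lee_fin; apply: le_trans (cmod_Im _) _.
  by apply: le_trans (gB t tD) _; exact: ler_norm.
Qed.

(** The two components are bounded separately; the resulting factor [2] is harmless in all four
    conditions. *)
Lemma cmod_cintegral_le (g : R -> C) (B : R -> R) : cintegrable mu D g ->
  mu.-integrable D (EFin \o B) -> (forall t, D t -> cmod (g t) <= B t) ->
  cmod (cintegral mu D g) <= 2 * Rintegral mu D B.
Proof.
move=> [iRe iIm] iB gB; apply: le_trans (cmod_le_ReIm _) _ => /=.
have part (u : R -> R) : mu.-integrable D (EFin \o u) ->
    (forall t, D t -> `|u t| <= B t) -> `|Rintegral mu D u| <= Rintegral mu D B.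
  move=> iu uB; apply: le_trans (le_normr_Rintegral _ iu) _ => //.
  by apply: le_Rintegral => //; exact: (integrable_abse iu).
rewrite mulrDl mul1r lerD// part// => t tD.
  by apply: le_trans (cmod_Re _) (gB t tD).
by apply: le_trans (cmod_Im _) (gB t tD).
Qed.

Lemma eq_cintegral (g1 g2 : R -> C) : (forall t, D t -> g1 t = g2 t) ->
  cintegral mu D g1 = cintegral mu D g2.
Proof.
move=> e; rewrite /cintegral; congr Complex; apply: eq_Rintegral => t;
  by rewrite inE => /e ->.
Qed.

Lemma cintegrableB (g1 g2 : R -> C) : cintegrable mu D g1 -> cintegrable mu D g2 ->
  cintegrable mu D (fun t => g1 t - g2 t).
Proof.
move=> [r1 i1] [r2 i2]; split.
  apply: eq_integrable (integrableB _ r1 r2) => // t _.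
  by rewrite /= cReB.
apply: eq_integrable (integrableB _ i1 i2) => // t _.
by rewrite /= cImB.
Qed.

Lemma cintegrableMr (g : R -> C) (c : C) : cintegrable mu D g ->
  cintegrable mu D (fun t => g t * c).
Proof.
move=> [r i].
have rZ (u : R -> R) k : mu.-integrable D (EFin \o u) ->
    mu.-integrable D (EFin \o (fun t => u t * k)).
  by move=> iu; exact: (integrableZr _ k iu).
split.
  apply: eq_integrable (integrableB _ (rZ _ (complex.Re c) r) (rZ _ (complex.Im c) i)) => // t _.
  by rewrite /= cReM.
apply: eq_integrable (integrableD _ (rZ _ (complex.Im c) r) (rZ _ (complex.Re c) i)) => // t _.
by rewrite /= cImM.
Qed.

Lemma cintegralB (g1 g2 : R -> C) : cintegrable mu D g1 -> cintegrable mu D g2 ->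
  cintegral mu D (fun t => g1 t - g2 t) = cintegral mu D g1 - cintegral mu D g2.
Proof.
move=> [r1 i1] [r2 i2]; apply/eqP; rewrite eq_complex cReB cImB /=.
rewrite -!RintegralB//; apply/andP; split; apply/eqP; apply: eq_Rintegral => t _.
  by rewrite cReB.
by rewrite cImB.
Qed.

Lemma cintegralMr (g : R -> C) (c : C) : cintegrable mu D g ->
  cintegral mu D (fun t => g t * c) = cintegral mu D g * c.
Proof.
move=> [r i].
have rZ (u : R -> R) k : mu.-integrable D (EFin \o u) ->
    mu.-integrable D (EFin \o (fun t => u t * k)).
  by move=> iu; exact: (integrableZr _ k iu).
apply/eqP; rewrite eq_complex cReM cImM /=.
rewrite -!RintegralZr// -RintegralB ?rZ// -RintegralD ?rZ//.
apply/andP; split; apply/eqP; apply: eq_Rintegral => t _.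
  by rewrite cReM.
by rewrite cImM.
Qed.

Lemma holomorphic_measurable q : holomorphic_disc q ->
  measurable_fun D (fun t => complex.Re (q (Complex t 0))) /\
  measurable_fun D (fun t => complex.Im (q (Complex t 0))).
Proof.
move=> hq.
have cq t : t \in D ->
    {for t, continuous (fun t => complex.Re (q (Complex t 0)))} /\
    {for t, continuous (fun t => complex.Im (q (Complex t 0)))}.
  rewrite inE /= in_itv /= => t01; apply: ccontinuous_real.
  by apply: cderivable_continuous; apply: hq; exact: disc_real.
split; apply: subspace_continuous_measurable_fun => //;
  by apply: continuous_in_subspaceT => t /cq[].
Qed.

(** * Functions dominated by a multiple of [1 / v] *)

Hypothesis wv : weight v.
Hypothesis iv : mu.-integrable D (fun t => ((v t)^-1)%:E).

Let V := Rintegral mu D (fun t => (v t)^-1).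

Let vpos t : D t -> 0 < (v t)^-1.
Proof. by rewrite /= in_itv /= => t01; rewrite invr_gt0; case: wv => + _ _ _; exact. Qed.

Lemma inv_weight_integral_ge0 : 0 <= V.
Proof. by apply: Rintegral_ge0 => t /vpos/ltW. Qed.

Definition weight_bound f (M : R) := forall t, D t -> cmod (f (Complex t 0)) <= M * (v t)^-1.

(** The kernel, its derivative, its Taylor remainders and the powers [x ^+ k] all have the form of
    this bounded holomorphic factor [q]; integrability and size of the corresponding integrals are
    obtained here once for all. *)
Lemma cintegral_weighted f q (M B : R) : holomorphic_disc f -> holomorphic_disc q ->
  0 <= B -> weight_bound f M -> (forall t, D t -> cmod (q (Complex t 0)) <= B) ->
  cintegrable mu D (fun t => f (Complex t 0) * q (Complex t 0)) /\
  cmod (cintegral mu D (fun t => f (Complex t 0) * q (Complex t 0))) <= 2 * (M * B * V).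
Proof.
move=> hf hq B0 fM qB.
have iB : mu.-integrable D (EFin \o (fun t => M * B * (v t)^-1)).
  exact: (integrableZl _ (M * B) iv).
have bd t : D t -> cmod (f (Complex t 0) * q (Complex t 0)) <= M * B * (v t)^-1.
  move=> tD; rewrite cmodM mulrAC; apply: ler_pM; rewrite ?cmod_ge0//.
    exact: fM.
  exact: qB.
have hfq : holomorphic_disc (fun z => f z * q z).
  by move=> z zD; apply: cderivableM; [exact: hf|exact: hq].
have [mR mI] := holomorphic_measurable hfq.
have ifq := cintegrable_dominated mR mI iB bd.
split=> //; apply: le_trans (cmod_cintegral_le ifq iB bd) _.
by rewrite RintegralZl.
Qed.

Definition geom_kernel z : C -> C := fun x => (1 - x * z)^-1.

Lemma geom_kernel_lower (x z : C) : cmod x <= 1 -> 1 - cmod z <= cmod (1 - x * z).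
Proof.
move=> x1; apply: le_trans (cmod_sub_le _ _); rewrite cmod1 cmodM lerD2l lerN2.
by rewrite ler_piMl ?cmod_ge0.
Qed.

Lemma geom_kernel_neq0 (x z : C) : cmod x <= 1 -> disc z -> 1 - x * z != 0.
Proof.
move=> x1 zD; rewrite -cmod_gt0; apply: lt_le_trans (geom_kernel_lower z x1).
by rewrite subr_gt0.
Qed.

Lemma holomorphic_geom_kernel z : disc z -> holomorphic_disc (geom_kernel z).
Proof.
move=> zD x xD; apply: (@cderivableV _ (fun x => 1 - x * z)).
  by apply: geom_kernel_neq0 => //; exact: ltW.
apply: cderivableD; first exact: cderivable_cst.
rewrite (_ : (fun _ => _) = (fun x => x * - z)); last by apply/funext => y; rewrite mulrN.
by apply: cderivableM; [exact: cderivable_id|exact: cderivable_cst].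
Qed.

Lemma cmod_real_itv t : D t -> cmod (Complex t 0) <= 1.
Proof.
by rewrite /= in_itv /= => /andP[t0 t1]; rewrite cmod_real ger0_norm// ltW.
Qed.

Lemma geom_kernel_bound t z : D t -> disc z ->
  cmod (geom_kernel z (Complex t 0)) <= (1 - cmod z)^-1.
Proof.
move=> tD zD; have x1 := cmod_real_itv tD.
have d0 : 0 < 1 - cmod z by rewrite subr_gt0.
have k0 := geom_kernel_neq0 x1 zD.
by rewrite cmodV lef_pV2 ?posrE ?cmod_gt0// geom_kernel_lower.
Qed.

Lemma Imu_weighted f z (M : R) : holomorphic_disc f -> weight_bound f M -> disc z ->
  cintegrable mu D (Imu_kernel f z) /\
  cmod (Imu mu f z) <= 2 * (M * (1 - cmod z)^-1 * V).
Proof.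
move=> hf fM zD; apply: (cintegral_weighted hf (holomorphic_geom_kernel zD) _ fM).
  by rewrite invr_ge0 subr_ge0 ltW.
by move=> t tD; exact: geom_kernel_bound.
Qed.

Definition Phi (r : R) := Rintegral mu D (fun t => (v t * (1 - t * r))^-1).

Lemma Phi_integrable (r : R) : 0 <= r < 1 ->
  mu.-integrable D (EFin \o (fun t => (v t * (1 - t * r))^-1)).
Proof.
move=> r01; have rD := disc_real r01; have [r0 r1] := andP r01.
have iB : mu.-integrable D (EFin \o (fun t => (v t)^-1 * (1 - r)^-1)).
  exact: (integrableZr _ ((1 - r)^-1) iv).
have mv : measurable_fun D (fun t => (v t)^-1).
  by apply/measurable_EFinP; exact: (measurable_int mu iv).
(* The real kernel [1 / (1 - t r)] is the holomorphic one at the real point [r], and inherits its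
   measurability. *)
have [mk _] := holomorphic_measurable (holomorphic_geom_kernel rD).
have kE t : geom_kernel (Complex r 0) (Complex t 0) = Complex ((1 - t * r)^-1) 0.
  rewrite /geom_kernel (_ : 1 - _ = ((1 - t * r)%:C)%C); last first.
    by rewrite rmorphB rmorphM rmorph1.
  by rewrite -fmorphV.
apply: (le_integrable _ _ _ iB) => //.
  apply/measurable_EFinP.
  rewrite (_ : (fun t => _) = (fun t => (v t)^-1 *
      complex.Re (geom_kernel (Complex r 0) (Complex t 0)))); last first.
    by apply/funext => t; rewrite kE /= invfM.
  exact: measurable_funM.
move=> t tD; have /andP[t0 t1] : 0 <= t < 1 by move: tD; rewrite /= in_itv.
have tr : t * r <= r by rewrite ler_piMl// ltW.
rewrite /= lee_fin invfM !normrM ler_wpM2l//.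
rewrite !ger0_norm ?invr_ge0 ?subr_ge0 ?(ltW r1)// ?(le_trans tr (ltW r1))//.
by rewrite lef_pV2 ?posrE ?subr_gt0 ?(le_lt_trans tr)// lerD2l lerN2.
Qed.

Lemma Phi_le (r : R) : 0 <= r < 1 -> 0 <= Phi r <= (1 - r)^-1 * V.
Proof.
move=> r01; have [r0 r1] := andP r01; apply/andP; split.
  apply: Rintegral_ge0 => t tD; have vt := vpos tD.
  have /andP[t0 t1] : 0 <= t < 1 by move: tD; rewrite /= in_itv.
  by rewrite invfM mulr_ge0 ?(ltW vt)// invr_ge0 subr_ge0 mulr_ile1// ltW.
rewrite /V -RintegralZl//; apply: le_Rintegral => //.
- exact: Phi_integrable.
- exact: (integrableZl _ _ iv).
move=> t tD; have vt := vpos tD.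
have /andP[t0 t1] : 0 <= t < 1 by move: tD; rewrite /= in_itv.
have tr : t * r <= r by rewrite ler_piMl// ltW.
rewrite invfM mulrC ler_wpM2r ?(ltW vt)//.
by rewrite lef_pV2 ?posrE ?subr_gt0 ?(le_lt_trans tr)// lerD2l lerN2.
Qed.

Lemma Imu_Phi f z (M : R) : holomorphic_disc f -> weight_bound f M -> disc z ->
  cmod (Imu mu f z) <= 2 * (M * Phi (cmod z)).
Proof.
move=> hf fM zD; have [ik _] := Imu_weighted hf fM zD.
have z01 : 0 <= cmod z < 1 by rewrite cmod_ge0.
have iP := Phi_integrable z01.
rewrite /Phi -RintegralZl//; apply: cmod_cintegral_le => //.
  exact: (integrableZl _ _ iP).
move=> t tD; have /andP[t0 t1] : 0 <= t < 1 by move: tD; rewrite /= in_itv.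
have tz : 0 < 1 - t * cmod z.
  by rewrite subr_gt0; apply: le_lt_trans zD; rewrite ler_piMl ?cmod_ge0// ltW.
rewrite /Imu_kernel cmodM cmodV invfM mulrA; apply: ler_pM; rewrite ?cmod_ge0 ?invr_ge0 ?cmod_ge0//.
  exact: fM.
have low : 1 - t * cmod z <= cmod (1 - Complex t 0 * z).
  by apply: le_trans (cmod_sub_le _ _); rewrite cmod1 cmodM cmod_real ger0_norm.
by rewrite lef_pV2 ?posrE// (lt_le_trans tz).
Qed.

(** Integrates the identity [1/u' - 1/u - x h / u^2 = x^2 h^2 / (u^2 u')] with [u = 1 - x z] and
    [u' = 1 - x (z + h)]. Both denominators are at least [d] in modulus, and the constants depend on
    [f] only through [M], so the estimate is uniform on the unit ball. *)
Lemma Imu_second_order f z (M d : R) : holomorphic_disc f -> weight_bound f M -> 0 <= M ->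
  0 < d -> cmod z + 2 * d <= 1 -> exists L : C,
  cmod L <= 2 * (M * (d^-1 ^+ 2) * V) /\
  forall h, 0 < cmod h < d -> disc (z + h) /\
    cmod ((Imu mu f (z + h) - Imu mu f z) / h - L) <= 2 * (M * (d^-1 ^+ 3) * V) * cmod h.
Proof.
move=> hf fM M0 d0 zd; have z0 := cmod_ge0 z.
have zD : disc z by rewrite /disc /=; lra.
have kz t : D t -> cmod (geom_kernel z (Complex t 0)) <= d^-1.
  move=> tD; apply: le_trans (geom_kernel_bound tD zD) _.
  by rewrite lef_pV2 ?posrE//; lra.
pose q x := x * (geom_kernel z x) ^+ 2.
have hk2 z' : disc z' -> holomorphic_disc (fun x => (geom_kernel z' x) ^+ 2).
  move=> z'D x xD; rewrite (_ : (fun _ => _) = (fun x => geom_kernel z' x * geom_kernel z' x)).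
    by apply: cderivableM; exact: holomorphic_geom_kernel.
  by apply/funext => y; rewrite expr2.
have hq : holomorphic_disc q.
  by move=> x xD; apply: cderivableM; [exact: cderivable_id|exact: hk2].
have dV n : 0 <= d^-1 ^+ n by rewrite exprn_ge0// invr_ge0 ltW.
have qb t : D t -> cmod (q (Complex t 0)) <= d^-1 ^+ 2.
  move=> tD; rewrite cmodM cmodX -[leRHS]mul1r.
  apply: ler_pM; rewrite ?cmod_ge0 ?exprn_ge0 ?cmod_ge0// ?cmod_real_itv//.
  by apply: lerXn2r; rewrite ?nnegrE ?cmod_ge0 ?kz ?invr_ge0 ?ltW.
have [iq Lb] := cintegral_weighted hf hq (dV 2%N) fM qb.
exists (cintegral mu D (fun t => f (Complex t 0) * q (Complex t 0))); split=> // h /andP[h0 hd].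
have hn0 : h != 0 by rewrite -cmod_gt0.
have zhd : cmod (z + h) + d <= 1 by have := cmodD z h; lra.
have zhD : disc (z + h) by rewrite /disc /=; lra.
split=> //.
have kzh t : D t -> cmod (geom_kernel (z + h) (Complex t 0)) <= d^-1.
  move=> tD; apply: le_trans (geom_kernel_bound tD zhD) _.
  by rewrite lef_pV2 ?posrE//; lra.
have [i1 _] := Imu_weighted hf fM zD; have [i2 _] := Imu_weighted hf fM zhD.
pose r x := x ^+ 2 * (geom_kernel z x) ^+ 2 * geom_kernel (z + h) x.
have hr : holomorphic_disc r.
  move=> x xD; apply: cderivableM; last exact: holomorphic_geom_kernel.
  by apply: cderivableM; [exact: cderivableX|exact: hk2].
have rb t : D t -> cmod (r (Complex t 0)) <= d^-1 ^+ 3.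
  move=> tD; rewrite cmodM cmodM !cmodX (exprSr _ 2%N).
  apply: ler_pM; rewrite ?mulr_ge0 ?exprn_ge0 ?cmod_ge0 ?kzh//.
  rewrite -[leRHS]mul1r.
  apply: ler_pM; rewrite ?exprn_ge0 ?cmod_ge0//.
    by rewrite exprn_ile1 ?cmod_ge0 ?cmod_real_itv.
  by apply: lerXn2r; rewrite ?nnegrE ?cmod_ge0 ?kz ?invr_ge0 ?ltW.
have [ir Rb] := cintegral_weighted hf hr (dV 3%N) fM rb.
set L := cintegral mu D (fun t => f (Complex t 0) * q (Complex t 0)).
have E : Imu mu f (z + h) - Imu mu f z - L * h =
    cintegral mu D (fun t => f (Complex t 0) * r (Complex t 0)) * (h * h).
  rewrite /Imu -cintegralB// /L -(cintegralMr h iq) -(cintegralMr (h * h) ir).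
  rewrite -cintegralB; [|exact: cintegrableB|exact: cintegrableMr].
  apply: eq_cintegral => t tD.
  have n1 := geom_kernel_neq0 (cmod_real_itv tD) zD.
  have n2 := geom_kernel_neq0 (cmod_real_itv tD) zhD.
  rewrite /Imu_kernel /q /r /geom_kernel; field.
  by rewrite n1 n2.
rewrite (_ : _ / h - L = (Imu mu f (z + h) - Imu mu f z - L * h) / h); last by field.
by rewrite E mulrA mulfK// cmodM ler_wpM2r ?cmod_ge0.
Qed.

End CauchyTransform.

(** * Compactness and vanishing at the boundary *)

Section Operator.
Variables (R : realType) (mu : {measure set R -> \bar R}) (v : R -> R).
Local Notation C := R[i].
Local Notation D := (`[0, 1[ : set R).
Implicit Types (f g : C -> C) (z : C).
Hypothesis wv : weight v.
Hypothesis iv : mu.-integrable D (fun t => ((v t)^-1)%:E).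

Let V := Rintegral mu D (fun t => (v t)^-1).
Let V0 : 0 <= V := inv_weight_integral_ge0 mu wv.

Definition moment f (k : nat) : C :=
  cintegral mu D (fun t => f (Complex t 0) * Complex t 0 ^+ k).

Lemma holomorphic_exprn (k : nat) : holomorphic_disc (fun x : C => x ^+ k).
Proof. by move=> z _; exact: cderivableX. Qed.

Lemma moment_integrable f (M : R) k : holomorphic_disc f -> weight_bound v f M ->
  cintegrable mu D (fun t => f (Complex t 0) * Complex t 0 ^+ k) /\
  cmod (moment f k) <= 2 * (M * 1 * V).
Proof.
move=> hf fM; apply: (cintegral_weighted iv hf (holomorphic_exprn k) ler01 fM).
by move=> t tD; rewrite cmodX exprn_ile1 ?cmod_ge0// cmod_real_itv.
Qed.

(** The finite geometric sum with its remainder [(t z) ^+ N / (1 - t z)]. The bound depends on [f]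
    only through [M], so finitely many moments determine the image on a smaller disc up to a uniform
    error. *)
Lemma Imu_moments f z (M : R) N : holomorphic_disc f -> weight_bound v f M -> disc z ->
  cmod (Imu mu f z - \sum_(k < N) moment f k * z ^+ k) <=
  2 * (M * (cmod z ^+ N * (1 - cmod z)^-1) * V).
Proof.
move=> hf fM zD; have z1 : 0 < 1 - cmod z by rewrite subr_gt0.
pose q n x := x ^+ n * geom_kernel z x.
have hq n : holomorphic_disc (q n).
  by move=> x xD; apply: cderivableM; [exact: cderivableX|exact: holomorphic_geom_kernel].
have qb n t : D t -> cmod (q n (Complex t 0)) <= (1 - cmod z)^-1.
  move=> tD; rewrite cmodM cmodX -[leRHS]mul1r.
  by apply: ler_pM; rewrite ?exprn_ge0 ?cmod_ge0 ?exprn_ile1 ?cmod_ge0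
    ?cmod_real_itv ?geom_kernel_bound.
have z1V : 0 <= (1 - cmod z)^-1 by rewrite invr_ge0 ltW.
have iq n := (cintegral_weighted iv hf (hq n) z1V fM (qb n)).1.
have bq n := (cintegral_weighted iv hf (hq n) z1V fM (qb n)).2.
have -> : Imu mu f z - \sum_(k < N) moment f k * z ^+ k =
    cintegral mu D (fun t => f (Complex t 0) * q N (Complex t 0)) * z ^+ N.
  elim: N => [|N IH].
    rewrite big_ord0 subr0 expr0 mulr1 /Imu; apply: eq_cintegral => t tD.
    by rewrite /q expr0 mul1r.
  rewrite big_ord_recr /= opprD addrA IH -mulrBl exprS mulrA; congr (_ * _).
  have iN := (moment_integrable N hf fM).1.
  rewrite /moment -cintegralB// -(cintegralMr z (iq N.+1)); apply: eq_cintegral => t tD.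
  have n1 := geom_kernel_neq0 (cmod_real_itv tD) zD.
  by rewrite /q /geom_kernel exprS; field.
rewrite cmodM cmodX (mulrC (cmod z ^+ N)).
apply: le_trans (ler_wpM2r (exprn_ge0 N (cmod_ge0 z)) (bq N)) _.
by rewrite le_eqVlt; apply/orP; left; apply/eqP; rewrite -/V; ring.
Qed.

Lemma Imu_holomorphic f (M : R) : holomorphic_disc f -> weight_bound v f M -> 0 <= M ->
  holomorphic_disc (Imu mu f).
Proof.
move=> hf fM M0 z zD; have z1 : cmod z < 1 := zD.
pose d := (1 - cmod z) / 2; have d0 : 0 < d by rewrite divr_gt0// subr_gt0.
have zd : cmod z + 2 * d <= 1 by rewrite /d; lra.
have [L [_ hL]] := Imu_second_order iv hf fM M0 d0 zd.
exists L => e e0; set B := 2 * _ in hL.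
have B1 : 0 < `|B| + 1 by rewrite ltr_wpDl.
exists (Num.min d (e / (`|B| + 1))); first by rewrite lt_min d0 divr_gt0.
move=> h /andP[h0]; rewrite lt_min => /andP[hd he].
have [|_] := hL h; first by rewrite h0.
move=> /le_lt_trans; apply; move: he; rewrite ltr_pdivlMr//; apply: le_lt_trans.
rewrite mulrC ler_wpM2l ?(ltW h0)//.
by apply: le_trans (ler_norm _) _; rewrite lerDl.
Qed.

Lemma Hinf_weight_bound f : Hinf v f -> weight_bound v f (wnorm v f).
Proof.
move=> [_ fM] t; rewrite /= in_itv /= => t01; have tD := disc_real t01.
have vt : 0 < v t by case: wv => + _ _ _; exact.
have := wnorm_ub fM tD; have /andP[t0 _] := t01.
by rewrite cmod_real ger0_norm// -ler_pdivlMl// mulrC.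
Qed.

Lemma Hinf_Imu_defined f : Hinf v f -> Imu_defined mu f.
Proof.
move=> Hf; have fM := Hinf_weight_bound Hf; have [hf _] := Hf; split.
  by move=> z zD; exact: (Imu_weighted iv hf fM zD).1.
exact: (Imu_holomorphic hf fM (wnorm_ge0 _ wv)).
Qed.

Lemma Imu_sub f g z : Hinf v f -> Hinf v g -> disc z ->
  Imu mu (fun x => g x - f x) z = Imu mu g z - Imu mu f z.
Proof.
move=> /Hinf_Imu_defined[fi _] /Hinf_Imu_defined[gi _] zD.
rewrite /Imu -cintegralB//; [|exact: gi|exact: fi].
by apply: eq_cintegral => t _; rewrite /Imu_kernel mulrBl.
Qed.

Lemma Imu_scale f (c : C) z : Hinf v f -> disc z ->
  Imu mu (fun x => f x * c) z = Imu mu f z * c.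
Proof.
move=> /Hinf_Imu_defined[fi _] zD.
rewrite /Imu -cintegralMr//; last exact: fi.
by apply: eq_cintegral => t _; rewrite /Imu_kernel mulrAC.
Qed.

Lemma Hinf_sub (u : R -> R) f g : weight u -> Hinf u f -> Hinf u g ->
  Hinf u (fun x => g x - f x).
Proof.
move=> wu [hf [M fM]] [hg [K gK]]; split.
  move=> z zD; apply: cderivableD; first exact: hg.
  rewrite (_ : (fun _ => _) = (fun x => f x * -1)).
    by apply: cderivableM; [exact: hf|exact: cderivable_cst].
  by apply/funext => x; rewrite mulrN1.
exists (K + M) => z zD; have uz := weight_gt0 wu zD.
apply: le_trans (ler_wpM2l (ltW uz) (cmodBD _ _)) _.
by rewrite mulrDr lerD ?fM ?gK.
Qed.

Lemma Hinf_scale (u : R -> R) f (c : C) : Hinf u f -> Hinf u (fun x => f x * c).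
Proof.
move=> [hf [M fM]]; split.
  by move=> z zD; apply: cderivableM; [exact: hf|exact: cderivable_cst].
exists (M * cmod c) => z zD; rewrite cmodM mulrA ler_wpM2r ?cmod_ge0//.
exact: fM.
Qed.

Lemma Hinf_one : Hinf v (fun=> 1).
Proof.
split; first by move=> z _; exact: cderivable_cst.
exists (v 0) => z zD; rewrite cmod1 mulr1.
by case: wv => _ _ mono _; apply: mono; rewrite ?cmod_ge0.
Qed.

(** * Dominated convergence for dilations *)

Lemma Rintegral_dominated_cvg (u_ : nat -> R -> R) (u B : R -> R) :
  (forall n, measurable_fun D (u_ n)) -> measurable_fun D u ->
  (forall t, D t -> u_ ^~ t @ \oo --> u t) ->
  mu.-integrable D (EFin \o B) -> (forall n t, D t -> `|u_ n t| <= B t) ->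
  (fun n => Rintegral mu D (u_ n)) @ \oo --> Rintegral mu D u.
Proof.
move=> mu_ mu' uu iB uB.
have := @dominated_convergence _ _ _ mu D (measurable_itv _)
  (fun n => EFin \o u_ n) (EFin \o u) (EFin \o B).
case.
- by move=> n; exact/measurable_EFinP.
- exact/measurable_EFinP.
- by apply: aeW => t tD; apply: cvg_EFin; [exact: nearW|exact: uu].
- exact: iB.
- by apply: aeW => t n tD; rewrite /= lee_fin uB.
- move=> iu _ h; apply: fine_cvg; rewrite /Rintegral fineK; first exact: h.
  exact: integrable_fin_num.
Qed.

(** Since [v] is non-increasing, [M / v (r t) <= M / v t]: all dilations share the integrable
    majorant of [f] itself. *)
Lemma Imu_dilation_cvg f (M : R) (r : nat -> R) z :
  holomorphic_disc f -> weight_bound v f M -> 0 <= M -> disc z ->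
  (forall n, 0 < r n < 1) -> r @ \oo --> (1 : R) ->
  forall e, 0 < e -> exists N, forall n, (N <= n)%N ->
    cmod (Imu mu (fun x => f (Complex (r n) 0 * x)) z - Imu mu f z) < e.
Proof.
move=> hf fM M0 zD r01 r1 e e0.
have [_ _ vmono _] := wv.
have hd n : holomorphic_disc (fun x => f (Complex (r n) 0 * x)).
  move=> x xD; have /andP[rn0 rn1] := r01 n.
  apply: (@cderivable_comp _ f (fun x => Complex (r n) 0 * x)).
    by apply: cderivableM; [exact: cderivable_cst|exact: cderivable_id].
  apply: hf; rewrite /disc /= cmodM cmod_real gtr0_norm//.
  by rewrite mulr_ilt1 ?cmod_ge0 ?ltW.
have hk g : holomorphic_disc g -> holomorphic_disc (fun x => g x * geom_kernel z x).
  by move=> hg x xD; apply: cderivableM; [exact: hg|exact: holomorphic_geom_kernel].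
have dM n : weight_bound v (fun x => f (Complex (r n) 0 * x)) M.
  move=> t tD; have /andP[rn0 rn1] := r01 n.
  have t01 : 0 <= t < 1 by move: tD; rewrite /= in_itv.
  have /andP[t0 t1] := t01.
  have rt : r n * t <= t by rewrite ler_piMl// ltW.
  have rtD : 0 <= r n * t < 1 by rewrite mulr_ge0 ?(ltW rn0)//= (le_lt_trans rt).
  have := fM (r n * t); rewrite /= in_itv /= => /(_ rtD).
  rewrite (_ : Complex (r n * t) 0 = Complex (r n) 0 * Complex t 0); last first.
    by apply/eqP; rewrite eq_complex /=; apply/andP; split; apply/eqP; ring.
  move=> /le_trans; apply; rewrite ler_wpM2l//.
  case: wv => v0 _ _ _; rewrite lef_pV2 ?posrE ?v0//.
  by apply: vmono => //; case/andP: rtD.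
have iB : mu.-integrable D (EFin \o (fun t => M * (1 - cmod z)^-1 * (v t)^-1)).
  exact: (integrableZl _ _ iv).
have kb g : weight_bound v g M -> forall t, D t ->
    cmod (g (Complex t 0) * geom_kernel z (Complex t 0)) <= M * (1 - cmod z)^-1 * (v t)^-1.
  move=> gM t tD; rewrite cmodM mulrAC; apply: ler_pM; rewrite ?cmod_ge0//.
    exact: gM.
  exact: geom_kernel_bound.
have e2 : 0 < e / 2 by rewrite divr_gt0.
have rz t : D t -> forall e', 0 < e' -> exists N, forall n, (N <= n)%N ->
    cmod (f (Complex (r n) 0 * Complex t 0) * geom_kernel z (Complex t 0) -
          f (Complex t 0) * geom_kernel z (Complex t 0)) < e'.
  move=> tD e' e'0; have t01 : 0 <= t < 1 by move: tD; rewrite /= in_itv.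
  have cf := cderivable_continuous (hf _ (disc_real t01)).
  have [d d0 hd'] := ccontinuousM cf (ccontinuous_cst (geom_kernel z (Complex t 0)) _) e'0.
  have /cvgrPdist_lt /(_ _ d0)[N _ hN] := r1; exists N => n /hN /= rd.
  have := hd' (Complex ((r n - 1) * t) 0).
  rewrite (_ : Complex t 0 + _ = Complex (r n) 0 * Complex t 0); last first.
    by apply/eqP; rewrite eq_complex /=; apply/andP; split; apply/eqP; ring.
  apply; have /andP[t0 t1] := t01.
  rewrite cmod_real normrM distrC; apply: le_lt_trans rd.
  by rewrite ler_piMr// ger0_norm// ltW.
have [mfR mfI] := holomorphic_measurable (hk _ hf).
have mdR n := (holomorphic_measurable (hk _ (hd n))).1.
have mdI n := (holomorphic_measurable (hk _ (hd n))).2.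
have cR : (fun n => Rintegral mu D (fun t => complex.Re
      (f (Complex (r n) 0 * Complex t 0) * geom_kernel z (Complex t 0)))) @ \oo -->
    Rintegral mu D (fun t => complex.Re (f (Complex t 0) * geom_kernel z (Complex t 0))).
  apply: (Rintegral_dominated_cvg mdR mfR _ iB).
    move=> t tD; apply/cvgrPdist_lt => e' e'0; have [N hN] := rz t tD e' e'0.
    exists N => // n /= /hN h; rewrite distrC -cReB; exact: le_lt_trans (cmod_Re _) h.
  by move=> n t tD; apply: le_trans (cmod_Re _) (kb _ (dM n) t tD).
have cI : (fun n => Rintegral mu D (fun t => complex.Im
      (f (Complex (r n) 0 * Complex t 0) * geom_kernel z (Complex t 0)))) @ \oo -->
    Rintegral mu D (fun t => complex.Im (f (Complex t 0) * geom_kernel z (Complex t 0))).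
  apply: (Rintegral_dominated_cvg mdI mfI _ iB).
    move=> t tD; apply/cvgrPdist_lt => e' e'0; have [N hN] := rz t tD e' e'0.
    exists N => // n /= /hN h; rewrite distrC -cImB; exact: le_lt_trans (cmod_Im _) h.
  by move=> n t tD; apply: le_trans (cmod_Im _) (kb _ (dM n) t tD).
have /cvgrPdist_lt /(_ _ e2)[N1 _ h1] := cR; have /cvgrPdist_lt /(_ _ e2)[N2 _ h2] := cI.
exists (maxn N1 N2) => n; rewrite geq_max => /andP[/h1 /= l1 /h2 /= l2].
apply: le_lt_trans (cmod_le_ReIm _) _; rewrite cReB cImB /= (splitr e).
by rewrite ltrD// distrC.
Qed.

(** * Condition (i) implies condition (ii) *)

Variable w : R -> R.
Hypothesis ww : weight w.

Definition Phi_vanishes := forall e, 0 < e -> exists2 s, 0 <= s < 1 &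
  forall r, s < r -> r < 1 -> w r * Phi mu v r < e.

Lemma Phi_vanishesP : (fun r => w r * Phi mu v r) x @[x --> 1^'-] --> 0 <-> Phi_vanishes.
Proof.
split=> [/cvgrPdist_lt c e e0|h].
  apply/near_left1P; near=> r; apply: le_lt_trans (ler_norm _) _.
  by rewrite -normrN -sub0r; near: r; exact: c.
apply/cvgrPdist_lt => e /h /near_left1P n; near=> r.
have r01 : 0 <= r < 1.
  by apply/andP; split; near: r; [exact: nbhs_left_ge|exact: nbhs_left_lt].
rewrite sub0r normrN ger0_norm; first by near: r.
have /andP[P0 _] := Phi_le wv iv r01.
by rewrite mulr_ge0// ltW//; case: ww => + _ _ _; exact.
Unshelve. all: by end_near. Qed.

(** Stated for an arbitrary [G], because it also has to cover the limit of a sequence of images,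
    which keeps the bound by [Phi] without being known to be an image. *)
Lemma H0_of_Phi_bound (G : C -> C) (K : R) : Phi_vanishes -> holomorphic_disc G -> 0 <= K ->
  (forall z, disc z -> cmod (G z) <= K * Phi mu v (cmod z)) -> H0 w G.
Proof.
move=> van hG K0 GK; have [w0 _ wmono _] := ww.
have zin z : disc z -> 0 <= cmod z < 1 by move=> zD; rewrite cmod_ge0.
have far e : 0 < e -> exists2 s, 0 <= s < 1 & forall z, disc z -> s < cmod z ->
    w (cmod z) * cmod (G z) < e.
  move=> e0; have K1 : 0 < K + 1 by rewrite ltr_wpDl.
  have [s s01 hs] := van _ (divr_gt0 e0 K1); exists s => // z zD sz.
  have := hs _ sz zD; rewrite ltr_pdivlMr//; apply: le_lt_trans.
  have wz := weight_gt0 ww zD; have /andP[P0 _] := Phi_le wv iv (zin z zD).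
  apply: le_trans (ler_wpM2l (ltW wz) (GK z zD)) _.
  rewrite mulrCA mulrC ler_wpM2l ?lerDl// mulr_ge0// ltW//.
split; last first.
  move=> e e0; have [s /andP[s0 s1] hs] := far _ e0.
  by exists s => // z zD sz; exact: hs.
split=> //; have [s /andP[s0 s1] hs] := far _ ltr01.
exists (1 + w 0 * (K * ((1 - s)^-1 * V))) => z zD.
have w00 : 0 < w 0 by apply: w0; rewrite lexx ltr01.
have s1V : 0 <= (1 - s)^-1 by rewrite invr_ge0 subr_ge0 ltW.
have [sz|zs] := ltP s (cmod z).
  apply: le_trans (ltW (hs z zD sz)) _; rewrite lerDl.
  by rewrite !mulr_ge0// ltW.
apply: le_trans (_ : w 0 * (K * ((1 - s)^-1 * V)) <= _); last by rewrite lerDr.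
have wz := weight_gt0 ww zD.
apply: ler_pM; rewrite ?cmod_ge0 ?(ltW wz)//.
  by apply: wmono; rewrite ?cmod_ge0.
apply: le_trans (GK z zD) _; rewrite ler_wpM2l//.
have /andP[_ h] := Phi_le wv iv (zin z zD); apply: le_trans h _.
rewrite ler_wpM2r// lef_pV2 ?posrE ?subr_gt0// lerD2l lerN2//.
Qed.

Lemma Phi_vanishes_maps : Phi_vanishes -> Imu_maps mu v (H0 w).
Proof.
move=> van f Hf; have def := Hinf_Imu_defined Hf; split=> //.
have [hf _] := Hf; have fM := Hinf_weight_bound Hf.
apply: (@H0_of_Phi_bound _ (2 * wnorm v f)) => //; first exact: def.2.
  by rewrite mulr_ge0// wnorm_ge0.
by move=> z zD; rewrite -mulrA; exact: Imu_Phi.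
Qed.

Lemma increasing_selection (P : nat -> nat -> Prop) :
  (forall j m, exists2 n, (m < n)%N & P j n) ->
  exists phi : nat -> nat, {homo phi : m n / (m < n)%N >-> (m < n)%N} /\
    forall j, P j (phi j).
Proof.
move=> H; have : forall jm : nat * nat, exists n, (jm.2 < n)%N /\ P jm.1 n.
  by move=> [j m]; have [n] := H j m; exists n.
move=> /choice[h hh].
pose phi := nat_rect (fun=> nat) (h (0, 0)%N) (fun j p => h (j.+1, p)).
exists phi; split; last by case=> [|j]; [exact: (hh (0, 0)%N).2|exact: (hh (j.+1, phi j)).2].
by apply: homo_ltn => [|j]; [exact: ltn_trans|exact: (hh (j.+1, phi j)).1].
Qed.

(* Along an ultrafilter the images converge pointwise; a subsequence along which
   all the moments converge gives convergence uniformly on compact sets. *)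
Lemma Phi_vanishes_compact : Phi_vanishes -> Imu_compact mu v w (H0 w).
Proof.
move=> van fs Hfs; have [w0 _ wmono _] := ww.
have hfs n : holomorphic_disc (fs n) by have [[]] := Hfs n.
have fs1 n : weight_bound v (fs n) 1.
  move=> t tD; apply: le_trans (Hinf_weight_bound (Hfs n).1 tD) _.
  rewrite ler_wpM2r ?(Hfs n).2// invr_ge0 ltW//; case: wv => + _ _ _; apply.
  by move: tD; rewrite /= in_itv.
pose F n := Imu mu (fs n).
have FPhi n z : disc z -> cmod (F n z) <= 2 * Phi mu v (cmod z).
  by move=> zD; rewrite -[Phi _ _ _]mul1r; exact: Imu_Phi.
have [U UU ooU] := nat_ultrafilter.
have [g hg Ug] : exists2 g, holomorphic_disc g & forall z, disc z -> ulim_to U (F ^~ z) (g z).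
  apply: holomorphic_ulim => z zD.
    by exists (2 * Phi mu v (cmod z)) => n; exact: FPhi.
  have z1 : cmod z < 1 := zD.
  pose d := (1 - cmod z) / 2; have d0 : 0 < d by rewrite divr_gt0// subr_gt0.
  have zd : cmod z + 2 * d <= 1 by rewrite /d; lra.
  have /choice[L hL] := fun n => Imu_second_order iv (hfs n) (fs1 n) ler01 d0 zd.
  exists d, (2 * (1 * (d^-1 ^+ 3) * V)), (2 * (1 * (d^-1 ^+ 2) * V)), L.
  by split=> // [n|n h h0]; [exact: (hL n).1|exact: (hL n).2].
have gPhi z : disc z -> cmod (g z) <= 2 * Phi mu v (cmod z).
  move=> zD; rewrite -(subr0 (g z)); apply: (ulim_le UU (Ug z zD)).
  by apply: (@filterS nat U _ _ _ _ filterT) => n _ /=; rewrite subr0; exact: FPhi.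
have /choice[A hA] : forall k, exists a, ulim_to U (fun n => moment (fs n) k) a.
  move=> k; apply: (@ulim_bounded _ _ UU _ (2 * (1 * 1 * V))) => n.
  exact: (moment_integrable k (hfs n) (fs1 n)).2.
(* At stage [j] the moments of index at most [j] are within [1 / (j + 1)] of their limits. These are
   finitely many conditions, so their conjunction holds on a set of [U], which meets every tail of
   [nat]. *)
have [phi [phi_incr hphi]] : exists phi : nat -> nat,
    {homo phi : m n / (m < n)%N >-> (m < n)%N} /\
    forall j k, (k <= j)%N -> cmod (moment (fs (phi j)) k - A k) < j.+1%:R^-1.
  apply: (@increasing_selection (fun j n => forall k, (k <= j)%N ->
    cmod (moment (fs n) k - A k) < j.+1%:R^-1)) => j m.
  have UI i : U [set n | forall k, (k < i)%N -> cmod (moment (fs n) k - A k) < j.+1%:R^-1].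
    elim: i => [|i IH].
      by apply: (@filterS nat U _ _ _ _ filterT) => n _ k; rewrite ltn0.
    have Ui : U [set n | cmod (moment (fs n) i - A i) < j.+1%:R^-1].
      by apply: hA; rewrite invr_gt0 ltr0n.
    have UII : U ([set n | forall k, (k < i)%N -> cmod (moment (fs n) k - A k) < j.+1%:R^-1]
        `&` [set n | cmod (moment (fs n) i - A i) < j.+1%:R^-1]) by exact: filterI.
    apply: (@filterS nat U _ _ _ _ UII).
    move=> n /= [h1 h2] k; rewrite ltnS leq_eqVlt => /orP[/eqP ->//|]; exact: h1.
  have Um : U [set n | (m < n)%N] by apply: ooU; exists m.+1.
  have UII : U ([set n | forall k, (k < j.+1)%N -> cmod (moment (fs n) k - A k) < j.+1%:R^-1]
      `&` [set n | (m < n)%N]) by apply: filterI; [exact: UI|exact: Um].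
  by have [n [h1 h2]] := filter_ex UII; exists n.
have remainder n z N : disc z -> cmod (F n z - \sum_(k < N) moment (fs n) k * z ^+ k) <=
    2 * (1 * (cmod z ^+ N * (1 - cmod z)^-1) * V).
  by move=> zD; exact: Imu_moments.
have gremainder z N : disc z -> cmod (g z - \sum_(k < N) A k * z ^+ k) <=
    2 * (1 * (cmod z ^+ N * (1 - cmod z)^-1) * V).
  move=> zD; rewrite -[X in cmod X]subr0.
  have lim : ulim_to U (fun n => F n z - \sum_(k < N) moment (fs n) k * z ^+ k)
      (g z - \sum_(k < N) A k * z ^+ k).
    elim: N => [|N IH].
      move=> e /(Ug z zD) h; apply: (@filterS nat U _ _ _ _ h) => n /=.
      by rewrite !big_ord0 !subr0.
    have h := ulimB UU IH (ulimMl UU (z ^+ N) (hA N)).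
    move=> e /h h'; apply: (@filterS nat U _ _ _ _ h') => n /=.
    by rewrite !big_ord_recr /= !opprD !addrA.
  apply: (ulim_le UU lim); apply: (@filterS nat U _ _ _ _ filterT) => n _ /=.
  by rewrite subr0; exact: remainder.
exists phi, g; split => //; first exact: (@H0_of_Phi_bound _ 2).
apply/cvgrPdist_lt => e e0.
(* Near the circle the difference is at most [4 * Phi], which yields [e / 2]. On [cmod z <= s] the
   two Taylor remainders together take [e / 4], fixing [N], and the first [N] moments take another
   [e / 4], fixing [J]. *)
have e8 : 0 < e / 8 by rewrite divr_gt0.
have [s /andP[s0 s1] hs] := van _ e8.
have w00 : 0 < w 0 by apply: w0; rewrite lexx ltr01.
have [N hN] : exists N, w 0 * (4 * (s ^+ N * (1 - s)^-1 * V)) < e / 4.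
  have s1' : `|s| < 1 by rewrite ger0_norm.
  have e4 : 0 < e / 4 by rewrite divr_gt0.
  have /cvgrPdist_lt /(_ _ e4)[N _ /(_ N (leqnn N))] :=
    cvg_geometric (w 0 * (4 * ((1 - s)^-1 * V))) s1'.
  rewrite /= sub0r normrN => /(le_lt_trans (ler_norm _)) h; exists N.
  by apply: le_lt_trans h; rewrite le_eqVlt; apply/orP; left; apply/eqP; ring.
have [J hJ] : exists J, forall j, (J <= j)%N -> w 0 * (N%:R * j.+1%:R^-1) < e / 4.
  have [J hJ] : exists J : nat, w 0 * N%:R / (e / 4) < J%:R.
    by exists (Num.truncn (w 0 * N%:R / (e / 4))).+1; exact: truncnS_gt.
  exists J => j Jj; rewrite mulrA ltr_pdivrMr ?ltr0n//.
  rewrite -ltr_pdivrMl ?divr_gt0// mulrC; apply: lt_le_trans hJ _.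
  by rewrite ler_nat ltnW.
exists (maxn J N) => // j; rewrite /= geq_max => /andP[Jj Nj].
rewrite sub0r normrN ger0_norm; last exact: wnorm_ge0.
apply: le_lt_trans (_ : e / 2 < e); last by lra.
apply: wnorm_le => z zD; have wz := weight_gt0 ww zD.
have z1 : cmod z < 1 := zD.
have [sz|zs] := ltP s (cmod z).
  have h : cmod (Imu mu (fs (phi j)) z - g z) <= 4 * Phi mu v (cmod z).
    apply: le_trans (cmodBD _ _) _.
    by have := FPhi (phi j) z zD; have := gPhi z zD; rewrite /F; lra.
  apply: le_trans (ler_wpM2l (ltW wz) h) _; rewrite mulrCA.
  by have := hs _ sz zD; lra.
have wz0 : w (cmod z) <= w 0 by apply: wmono; rewrite ?cmod_ge0.
have z0 := cmod_ge0 z.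
have rem : cmod z ^+ N * (1 - cmod z)^-1 <= s ^+ N * (1 - s)^-1.
  apply: ler_pM; rewrite ?exprn_ge0 ?invr_ge0 ?subr_ge0 ?(ltW z1)//.
    by apply: lerXn2r; rewrite ?nnegrE.
  by rewrite lef_pV2 ?posrE ?subr_gt0// lerD2l lerN2.
have sums : cmod (\sum_(k < N) moment (fs (phi j)) k * z ^+ k - \sum_(k < N) A k * z ^+ k) <=
    N%:R * j.+1%:R^-1.
  rewrite -sumrB -[X in X%:R * _](card_ord N) mulr_natl -sumr_const.
  elim/big_ind2 : _ => [|x1 x2 y1 y2 h1 h2|k _].
  - by rewrite cmod0.
  - by apply: le_trans (cmodD _ _) _; exact: lerD.
  - rewrite -mulrBl cmodM cmodX -[leRHS]mulr1.
    apply: ler_pM; rewrite ?exprn_ge0 ?cmod_ge0 ?exprn_ile1 ?(ltW z1)//.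
    by rewrite ltW// hphi// (leq_trans _ Nj)// ltnW.
have tri : cmod (Imu mu (fs (phi j)) z - g z) <=
    4 * (s ^+ N * (1 - s)^-1 * V) + N%:R * j.+1%:R^-1.
  set S1 := \sum_(k < N) _ in sums; set S2 := \sum_(k < N) _ in sums.
  have b1 : cmod (Imu mu (fs (phi j)) z - S1) <= 2 * (cmod z ^+ N * (1 - cmod z)^-1 * V).
    by have := remainder (phi j) z N zD; rewrite mul1r.
  have b2 : cmod (S2 - g z) <= 2 * (cmod z ^+ N * (1 - cmod z)^-1 * V).
    by have := gremainder z N zD; rewrite mul1r cmodB.
  have b3 := ler_wpM2r V0 rem.
  have b4 := cmod_tri (Imu mu (fs (phi j)) z) S1 (g z).
  have b5 := cmod_tri S1 S2 (g z).
  move: b1 b2 b3 b4 b5 sums; clear.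
  move: (cmod z ^+ N * _ * _) (s ^+ N * _ * _) (N%:R * _) => x y n; lra.
apply: le_trans (ler_pM (ltW wz) (cmod_ge0 _) wz0 tri) _.
rewrite [leLHS]mulrDr; apply: le_trans (ltW (ltrD hN (hJ j Jj))) _; lra.
Qed.

(** * Condition (iii) implies condition (iv) *)

Lemma compact_operator_bounded : Imu_maps mu v (Hinf w) -> Imu_compact mu v w (Hinf w) ->
  exists B, forall f, Hinf v f -> wnorm v f <= 1 -> wnorm w (Imu mu f) <= B.
Proof.
move=> maps cpt; apply: contrapT => /forallNP nB.
have : forall n : nat, exists f, [/\ Hinf v f, wnorm v f <= 1 & n%:R < wnorm w (Imu mu f)].
  move=> n; apply: contrapT => /forallNP no; apply: (nB n%:R) => f Hf f1.
  by rewrite leNgt; apply/negP => lt; apply: (no f).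
move=> /choice[fs hfs].
have [phi [g [incr Hg cvg]]] := cpt fs (fun n => let: And3 a b _ := hfs n in conj a b).
have /cvgrPdist_lt /(_ _ ltr01)[N _ hN] := cvg.
have phi_ge n : (n <= phi n)%N.
  by elim: n => // n IH; apply: leq_ltn_trans IH _; exact: incr.
pose n := maxn N (Num.truncn (1 + wnorm w g)).+1.
have := hN n (leq_maxl _ _); rewrite /= sub0r normrN => /(le_lt_trans (ler_norm _)) h1.
have [Hf f1 big] := hfs (phi n).
have [_ Hi] := maps _ Hf.
have : wnorm w (Imu mu (fs (phi n))) <= 1 + wnorm w g.
  apply: wnorm_le => z zD; have wz := weight_gt0 ww zD.
  have h2 := wnorm_ub (Hinf_sub ww Hg Hi).2 zD.
  have h3 := wnorm_ub Hg.2 zD.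
  have : cmod (Imu mu (fs (phi n)) z) <= cmod (Imu mu (fs (phi n)) z - g z) + cmod (g z).
    by apply: le_trans (cmodD _ _); rewrite subrK.
  move=> /(ler_wpM2l (ltW wz)); rewrite mulrDr; lra.
apply/negP; rewrite -ltNge; apply: le_lt_trans big.
apply: le_trans (ltW (truncnS_gt _)) _; rewrite ler_nat.
by apply: leq_trans (phi_ge n); exact: leq_maxr.
Qed.

Lemma bounded_operator_continuous (B : R) : Imu_maps mu v (Hinf w) ->
  (forall f, Hinf v f -> wnorm v f <= 1 -> wnorm w (Imu mu f) <= B) ->
  Imu_continuous mu v w.
Proof.
move=> maps bd f Hf e e0; have B1 : 0 < `|B| + 1 by rewrite ltr_wpDl.
exists (e / (`|B| + 1)); first exact: divr_gt0.
move=> g Hg gd; set d := e / _ in gd; have d0 : 0 < d by exact: divr_gt0.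
have Hs := Hinf_sub wv Hf Hg.
(* Dividing by [d] rather than by the norm of [g - f] covers the case [g = f] as well. *)
pose h x := (g x - f x) * Complex d^-1 0.
have Hh : Hinf v h by exact: Hinf_scale.
have h1 : wnorm v h <= 1.
  apply: wnorm_le => z zD; rewrite cmodM mulrA cmod_real gtr0_norm ?invr_gt0//.
  by rewrite ler_pdivrMr// mul1r; apply: le_trans (wnorm_ub Hs.2 zD) (ltW gd).
have hB := bd _ Hh h1; have [_ HI] := maps _ Hh.
apply: le_lt_trans (_ : d * `|B| < e); last first.
  by rewrite /d mulrAC ltr_pdivrMr// ltr_pM2l// ltrDl.
apply: wnorm_le => z zD.
have -> : Imu mu g z - Imu mu f z = Imu mu h z * Complex d 0.
  rewrite /h Imu_scale// Imu_sub// -mulrA.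
  rewrite (_ : Complex d^-1 0 * Complex d 0 = 1) ?mulr1//.
  by rewrite -[Complex d 0]/((d%:C)%C) -[Complex d^-1 0]/((d^-1%:C)%C)
    -rmorphM mulVf ?gt_eqF ?rmorph1.
rewrite cmodM cmod_real gtr0_norm// mulrA mulrC ler_wpM2l ?(ltW d0)//.
apply: le_trans (wnorm_ub HI.2 zD) _; exact: le_trans hB (ler_norm _).
Qed.

(** Since [cmod (1 - t z) >= 1 - t * cmod z], the image at [z] is controlled by the image of [1] at
    the real point [cmod z], where the kernel is positive and no cancellation occurs. *)
Lemma Imu_bounded_H0 f (M : R) : holomorphic_disc f ->
  (forall z, disc z -> cmod (f z) <= M) -> Hinf w (Imu mu f) ->
  H0 w (Imu mu (fun=> 1)) -> H0 w (Imu mu f).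
Proof.
move=> hf fM HI [_ van]; split=> // e e0.
have M0 : 0 <= M by apply: le_trans (fM 0 (disc0 R)); exact: cmod_ge0.
have M1 : 0 < 2 * M + 1 by lra.
have [s s1 hs] := van _ (divr_gt0 e0 M1); exists s => // z zD sz.
have [oi _] := Hinf_Imu_defined Hinf_one.
have zr : 0 <= cmod z < 1 by rewrite cmod_ge0.
pose z' : C := Complex (cmod z) 0.
have z'D : disc z' by exact: disc_real.
have z'z : cmod z' = cmod z by rewrite cmod_real ger0_norm// cmod_ge0.
have [iR _] := oi _ z'D.
have kern t : complex.Re (Imu_kernel (fun=> 1) z' t) = (1 - t * cmod z)^-1.
  rewrite /Imu_kernel mul1r (_ : 1 - _ = ((1 - t * cmod z)%:C)%C); last first.
    by rewrite rmorphB rmorphM rmorph1.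
  by rewrite -fmorphV.
have key : cmod (Imu mu f z) <= 2 * (M * complex.Re (Imu mu (fun=> 1) z')).
  rewrite /Imu /cintegral /= -RintegralZl//.
  have iM : mu.-integrable D (EFin \o (fun t => M * complex.Re (Imu_kernel (fun=> 1) z' t))).
    exact: (integrableZl _ M iR).
  have kb t : D t -> cmod (Imu_kernel f z t) <= M * complex.Re (Imu_kernel (fun=> 1) z' t).
    move=> tD; have t01 : 0 <= t < 1 by move: tD; rewrite /= in_itv.
    have /andP[t0 t1] := t01; have zD1 : cmod z < 1 := zD.
    have tz : 0 < 1 - t * cmod z.
      by rewrite subr_gt0; apply: le_lt_trans zD1; rewrite ler_piMl ?cmod_ge0// ltW.
    rewrite kern /Imu_kernel cmodM cmodV; apply: ler_pM; rewrite ?invr_ge0 ?cmod_ge0//.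
      by apply: fM; exact: disc_real.
    have low : 1 - t * cmod z <= cmod (1 - Complex t 0 * z).
      by apply: le_trans (cmod_sub_le _ _); rewrite cmod1 cmodM cmod_real ger0_norm.
    by rewrite lef_pV2 ?posrE// (lt_le_trans tz).
  apply: (cmod_cintegral_le _ iM kb).
  have hk : holomorphic_disc (fun x => f x * geom_kernel z x).
    by move=> x xD; apply: cderivableM; [exact: hf|exact: holomorphic_geom_kernel].
  have [mR mI] := holomorphic_measurable hk.
  exact: (cintegrable_dominated mR mI iM kb).
have wz := weight_gt0 ww zD.
have := hs z' z'D; rewrite z'z => /(_ sz); rewrite ltr_pdivlMr//; apply: le_lt_trans.
have re : complex.Re (Imu mu (fun=> 1) z') <= cmod (Imu mu (fun=> 1) z').
  by apply: le_trans (ler_norm _) (cmod_Re _).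
apply: le_trans (ler_wpM2l (ltW wz) key) _.
have h1 : M * complex.Re (Imu mu (fun=> 1) z') <= M * cmod (Imu mu (fun=> 1) z').
  by rewrite ler_wpM2l.
have c0 := cmod_ge0 (Imu mu (fun=> 1) z').
rewrite -mulrA ler_wpM2l ?(ltW wz)// mulrDr mulr1; lra.
Qed.

Lemma compact_maps_H0 : Imu_maps mu v (Hinf w) -> Imu_compact mu v w (Hinf w) ->
  H0 w (Imu mu (fun=> 1)) -> Imu_maps mu v (H0 w).
Proof.
move=> maps cpt one.
have [v0 _ vmono _] := wv.
suff unit f : Hinf v f -> wnorm v f <= 1 -> H0 w (Imu mu f).
  move=> f Hf; split; first exact: (maps f Hf).1.
  have n0 := wnorm_ge0 f wv; pose c := wnorm v f + 1; have c0 : 0 < c by rewrite ltr_wpDl.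
  have Hs : Hinf v (fun x => f x * Complex c^-1 0) by exact: Hinf_scale.
  have s1 : wnorm v (fun x => f x * Complex c^-1 0) <= 1.
    apply: wnorm_le => z zD; rewrite cmodM mulrA cmod_real gtr0_norm ?invr_gt0//.
    rewrite ler_pdivrMr// mul1r; apply: le_trans (wnorm_ub Hf.2 zD) _.
    by rewrite lerDl.
  have [_ van] := unit _ Hs s1; split; first exact: (maps f Hf).2.
  move=> e e0; have [r r1 hr] := van _ (divr_gt0 e0 c0); exists r => // z zD rz.
  have := hr z zD rz; rewrite Imu_scale// cmodM cmod_real gtr0_norm ?invr_gt0//.
  by rewrite mulrA ltr_pM2r ?invr_gt0.
move=> Hf f1; have [hf _] := Hf.
(* The shift by [2] makes [r 0] positive. *)
pose r (n : nat) : R := 1 - n.+2%:R^-1.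
have r01 n : 0 < r n < 1.
  rewrite /r subr_gt0 invf_lt1 ?ltr0n// ltr1n /=.
  by rewrite ltrBlDr ltrDl invr_gt0 ltr0n.
have r1 : r @ \oo --> (1 : R).
  apply/cvgrPdist_lt => e e0.
  exists (Num.truncn e^-1) => // n /= en; rewrite /r opprB addrC subrK.
  rewrite gtr0_norm ?invr_gt0 ?ltr0n// invf_plt ?posrE ?ltr0n//.
  by apply: lt_le_trans (truncnS_gt _) _; rewrite ler_nat ltnS (leq_trans en).
pose fs n (x : C) := f (Complex (r n) 0 * x).
have rz n z : disc z -> disc (Complex (r n) 0 * z) /\
    cmod (Complex (r n) 0 * z) = r n * cmod z /\ r n * cmod z <= cmod z.
  move=> zD; have /andP[rn0 rn1] := r01 n; have z1 : cmod z < 1 := zD.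
  have e : cmod (Complex (r n) 0 * z) = r n * cmod z by rewrite cmodM cmod_real gtr0_norm.
  have le : r n * cmod z <= cmod z by rewrite ler_piMl ?cmod_ge0// ltW.
  by split=> //; rewrite /disc /= e (le_lt_trans le).
have hfs n : holomorphic_disc (fs n).
  move=> x xD; apply: (@cderivable_comp _ f (fun x => Complex (r n) 0 * x)).
    by apply: cderivableM; [exact: cderivable_cst|exact: cderivable_id].
  by apply: hf; exact: (rz n x xD).1.
have fsb n z : disc z -> v (cmod z) * cmod (fs n z) <= 1.
  move=> zD; have [rzD [e le]] := rz n z zD; have /andP[rn0 _] := r01 n.
  apply: le_trans f1; apply: le_trans (wnorm_ub Hf.2 rzD).
  rewrite ler_wpM2r ?cmod_ge0// e; apply: vmono => //.
  by rewrite mulr_ge0 ?cmod_ge0// ltW.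
have Hfs n : Hinf v (fs n) /\ wnorm v (fs n) <= 1.
  by split; [split=> //; exists 1 => z; exact: fsb|apply: wnorm_le => z; exact: fsb].
have [phi [g [incr Hg cvg]]] := cpt fs Hfs.
have phi_ge n : (n <= phi n)%N.
  by elim: n => // n IH; apply: leq_ltn_trans IH _; exact: incr.
have fM := Hinf_weight_bound Hf; have n0 := wnorm_ge0 f wv.
have [_ HIf] := maps f Hf.
have diff n z : disc z -> w (cmod z) * cmod (Imu mu (fs (phi n)) z - g z) <=
    wnorm w (fun z => Imu mu (fs (phi n)) z - g z).
  move=> zD; have H := Hinf_sub ww Hg (maps _ (Hfs (phi n)).1).2.
  exact: (@wnorm_ub _ w (fun z => Imu mu (fs (phi n)) z - g z) z H.2 zD).
have small e : 0 < e -> exists N, forall n, (N <= n)%N ->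
    wnorm w (fun z => Imu mu (fs (phi n)) z - g z) < e.
  move=> e0; have /cvgrPdist_lt /(_ _ e0)[N _ hN] := cvg; exists N => n /hN /=.
  by rewrite sub0r normrN; apply: le_lt_trans; exact: ler_norm.
(* Compactness yields a norm limit [g] along a subsequence and dominated convergence a pointwise
   limit [Imu mu f]. Their equality upgrades the pointwise convergence to convergence in norm, under
   which vanishing at the boundary is preserved. *)
have gE z : disc z -> Imu mu f z = g z.
  move=> zD; have wz := weight_gt0 ww zD.
  apply/eqP; rewrite -subr_eq0 -cmod_eq0 eq_le cmod_ge0 andbT.
  apply/ler_addgt0Pr => e e0; rewrite add0r.
  have e2 : 0 < e / 2 by rewrite divr_gt0.
  have [N1 h1] := Imu_dilation_cvg hf fM n0 zD r01 r1 e2.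
  have [N2 h2] := small _ (mulr_gt0 wz e2).
  pose n := maxn N1 N2.
  have := h1 (phi n) (leq_trans (leq_maxl _ _) (phi_ge n)).
  have := le_lt_trans (diff n z zD) (h2 n (leq_maxr _ _)); rewrite ltr_pM2l//.
  have := cmod_tri (Imu mu f z) (Imu mu (fs (phi n)) z) (g z).
  by rewrite (cmodB (Imu mu f z) (Imu mu (fs (phi n)) z)) /fs; lra.
split=> // e e0; have e2 : 0 < e / 2 by rewrite divr_gt0.
have [N hN] := small _ e2; have := hN N (leqnn N).
have /andP[rn0 rn1] := r01 (phi N).
(* The dilation only sees points of modulus at most [r (phi N)], where [1 / v] is at most its value
   at that radius. *)
have bounded z : disc z -> cmod (fs (phi N) z) <= (v (r (phi N)))^-1.
  move=> zD; have [rzD [ez le]] := rz (phi N) z zD; have z1 : cmod z < 1 := zD.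
  have vr : 0 < v (r (phi N)) by apply: v0; rewrite ltW.
  rewrite -[leRHS]mul1r ler_pdivlMr// mulrC; apply: le_trans f1.
  apply: le_trans (wnorm_ub Hf.2 rzD).
  rewrite ler_wpM2r ?cmod_ge0// ez; apply: vmono => //.
    by rewrite mulr_ge0 ?cmod_ge0// ltW.
  by rewrite ler_piMr ?(ltW rn0)// ltW.
have [_ van] := Imu_bounded_H0 (hfs (phi N)) bounded (maps _ (Hfs (phi N)).1).2 one.
have [s s1 hs] := van _ e2; move=> dN; exists s => // z zD sz.
have wz := weight_gt0 ww zD.
have := hs z zD sz; have := le_lt_trans (diff N z zD) dN.
have := cmod_tri (Imu mu f z) (Imu mu (fs (phi N)) z) 0.
rewrite !subr0 gE// (cmodB (g z)) => /(ler_wpM2l (ltW wz)); rewrite mulrDr; lra.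
Qed.

(** * Condition (iv) implies condition (i) *)

Lemma maps_H0_Phi_vanishes : essential v -> Imu_maps mu v (H0 w) -> Phi_vanishes.
Proof.
move=> ess maps; have [f [c [Hf c0 fc]]] := dominating_function wv ess.
have [[fi _] [_ van]] := maps f Hf.
move=> e e0; have [s s1 hs] := van _ (mulr_gt0 c0 e0).
exists (Num.max 0 s); first by rewrite le_max lexx /= gt_max ltr01.
move=> r; rewrite gt_max => /andP[r0 sr] r1.
have r01 : 0 <= r < 1 by rewrite ltW.
have rD := disc_real r01.
have rr : cmod (Complex r 0) = r by rewrite cmod_real gtr0_norm.
have := hs (Complex r 0) rD; rewrite rr => /(_ sr) small.
have wr : 0 < w r by case: ww => + _ _ _; exact.
rewrite -(ltr_pM2l c0); apply: le_lt_trans small; rewrite mulrCA ler_wpM2l ?(ltW wr)//.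
apply: le_trans (cmod_Re _); apply: le_trans (ler_norm _) => /=.
have iP := Phi_integrable iv r01.
rewrite /Phi -RintegralZl//; apply: le_Rintegral => //.
- exact: (integrableZl _ _ iP).
- exact: (fi _ rD).1.
move=> t tD; have t01 : 0 <= t < 1 by move: tD; rewrite /= in_itv.
have /andP[t0 t1] := t01; have [Im0 Rec] := fc t t01.
have tr : 0 < 1 - t * r by rewrite subr_gt0 mulr_ilt1// ltW.
rewrite /Imu_kernel cReM Im0 mul0r subr0.
rewrite (_ : 1 - _ = ((1 - t * r)%:C)%C); last first.
  by rewrite rmorphB rmorphM rmorph1.
rewrite -fmorphV /= invfM mulrA ler_wpM2r// invr_ge0 ltW//.
Qed.

End Operator.

Unset Implicit Arguments.

Theorem theorem12 (R : realType) (mu : {measure set R -> \bar R}) (v w : R -> R) :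
  (mu `[0%R, 1%R[ < +oo)%E ->
  weight v -> weight w ->
  mu.-integrable `[0, 1[ (fun t => ((v t)^-1)%:E) ->
  let cond_i :=
    (fun r => w r * Rintegral mu `[0, 1[ (fun t => (v t * (1 - t * r))^-1))
      x @[x --> 1^'-] --> 0 in
  let cond_ii := Imu_maps mu v (H0 w) /\ Imu_compact mu v w (H0 w) in
  let cond_iii := [/\ Imu_maps mu v (Hinf w), Imu_compact mu v w (Hinf w)
                    & H0 w (Imu mu (fun _ => 1))] in
  let cond_iv := Imu_maps mu v (H0 w) /\ Imu_continuous mu v w in
  [/\ (cond_i -> cond_ii), (cond_ii -> cond_iii), (cond_iii -> cond_iv) &
      (essential v ->
        [/\ cond_i <-> cond_ii, cond_i <-> cond_iii & cond_i <-> cond_iv])].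
Proof.
move=> _ wv ww iv cond_i cond_ii cond_iii cond_iv.
have ciP : cond_i <-> Phi_vanishes mu v w := Phi_vanishesP wv iv ww.
have i_ii : cond_i -> cond_ii.
  move=> /ciP van; split; first exact: Phi_vanishes_maps.
  exact: Phi_vanishes_compact.
have ii_iii : cond_ii -> cond_iii.
  move=> [maps cpt]; split.
  - by move=> f /maps[? []].
  - by move=> fs /cpt[phi [g [? [Hg _] ?]]]; exists phi, g.
  - by have [] := maps _ (Hinf_one wv).
have iii_iv : cond_iii -> cond_iv.
  move=> [maps cpt one]; split; first exact: compact_maps_H0.
  have [B bd] := compact_operator_bounded ww maps cpt.
  exact: bounded_operator_continuous bd.
split=> // ess.
have iv_i : cond_iv -> cond_i.
  by move=> [maps _]; apply/ciP; exact: maps_H0_Phi_vanishes.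
by split; split; auto.
Qed.
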